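(* There exists a universal constant $C > 0$ such that the following holds. Let $A > 0$ and let $K \subset \mathbb{R}^n$ be an isotropic convex body. For $s > 0$ denote $K_s = K \cap (s B_2^n)$. Assume that $$ \left| \frac{\int_{K_s} |x|^2 d\mu_{K_s}(x)}{\int_K |x|^2 d\mu_K(x)} - 1 \right| \leq A $$ for any $s > 0$ with $Vol_n(K_s)/Vol_n(K) \in [1/8, 7/8]$. Then $$ \int_K \left( \frac{|x|^2}{n} - 1 \right)^2 d\mu_K(x) \leq C A^2. $$
   Context: A convex body in $\mathbb{R}^n$ is a bounded, open (nonempty) convex set; $Vol_n$ is Lebesgue measure; $\mu_K$ is the uniform probability measure on $K$ (and similarly $\mu_{K_s}$ on $K_s$). $B_2^n = \{x \in \mathbb{R}^n : |x| \leq 1\}$ is the Euclidean unit ball. $K$ is isotropic if its barycenter is at the origin and $\frac{1}{Vol_n(K)}\int_K \langle x,y\rangle^2 dy = |x|^2$ for all $x \in \mathbb{R}^n$. A universal constant is one independent of all parameters, including the dimension $n$. *)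

(* Defs.v *)
From HB Require Import structures.
From mathcomp Require Import all_boot all_order all_algebra.
From mathcomp Require Import all_classical all_reals all_analysis measurable_realfun.
From mathcomp Require Import ring lra.

Set Implicit Arguments.
Unset Strict Implicit.
Unset Printing Implicit Defensive.

Import Order.TTheory GRing.Theory Num.Theory.
Import numFieldNormedType.Exports.

Local Open Scope classical_set_scope.
Local Open Scope ring_scope.

Definition rV_display : measure_display.
Proof. exact: default_measure_display. Qed.

Section measurable_rV.
Context {R : realType} (n : nat).

Let coors : 'I_n -> 'rV[R]_n -> R := fun i v => v ord0 i.

(* The product sigma-algebra, built as the library does for n.-tuple; it is
   the Borel one: see open_measurable_rV for the nontrivial inclusion. *)
HB.instance Definition _ := @isMeasurable.Build rV_display 'rV[R]_n
  (g_sigma_preimage coors) (@sigma_algebra0 _ _ _) (@sigma_algebraC _ _)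
  (@sigma_algebra_bigcup _ _ _).

End measurable_rV.

Section measurable_rV_lemmas.
Context {R : realType}.

Lemma measurable_coord n (i : 'I_n) :
  measurable_fun [set: 'rV[R]_n] (fun v => v ord0 i).
Proof.
move=> _ Y mY; rewrite setTI; apply: sub_sigma_algebra => /=.
rewrite -bigcup_seq/=; exists i => /=; first by rewrite mem_index_enum.
by exists Y => //; rewrite setTI.
Qed.

Lemma measurable_fun_rVP d (T : measurableType d) n (f : T -> 'rV[R]_n) :
  (forall i, measurable_fun [set: T] (fun x => f x ord0 i)) ->
  measurable_fun [set: T] f.
Proof.
move=> mf.
apply: (@measurability _ _ _ _ setT f
  (\big[setU/set0]_(i < n) preimage_set_system setT
     (fun v : 'rV[R]_n => v ord0 i) measurable)).
  by [].
move=> _ [B + <-].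
rewrite -bigcup_seq => -[i _ [C mC <-]].
by have := mf i measurableT C mC; rewrite !setTI.
Qed.

Lemma open_measurable_rV n (U : set 'rV[R]_n) : open U -> measurable U.
Proof.
move=> oU.
pose box (p : 'rV[rat]_n * rat) : set 'rV[R]_n :=
  [set v | forall i, ball (ratr (p.1 ord0 i) : R) (ratr p.2) (v ord0 i)].
have mbox p : measurable (box p).
  rewrite (_ : box p = \bigcap_(i in [set: 'I_n])
     [set v | ball (ratr (p.1 ord0 i) : R) (ratr p.2) (v ord0 i)]); last first.
    by apply/seteqP; split => v /= H i => [_|]; apply: H.
  apply: fin_bigcap_measurable; first exact: finite_finset.
  move=> i _.
  have := @measurable_coord n i measurableT
    (ball (ratr (p.1 ord0 i) : R) (ratr p.2)).
  by rewrite setTI; apply; exact: measurable_ball.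
suff -> : U = \bigcup_p (if `[< box p `<=` U >] then box p else set0).
  apply: countable_bigcupT_measurable; first exact: countableP.
  by move=> p; case: ifPn => _; [exact: mbox|exact: measurable0].
apply/seteqP; split => [v Uv|v [p _]]; last first.
  by case: ifPn => // /asboolP; apply.
have /nbhs_ballP[e /= e0 eU] : nbhs v U by move: oU; rewrite openE; apply.
have [r r0 re] : exists2 r : rat, (0 : R) < ratr r & ratr r < e / 2 :> R.
  have e2 : 0 < e / 2 by rewrite divr_gt0.
  have [r] := rat_in_itvoo e2.
  by rewrite in_itv/= => /andP[? ?]; exists r.
have Hq i : exists q : rat, ball (ratr q : R) (ratr r) (v ord0 i).
  have vr : v ord0 i - ratr r < v ord0 i + ratr r by lra.
  have [q] := rat_in_itvoo vr.
  rewrite in_itv/= => /andP[q1 q2]; exists q.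
  by rewrite /ball/= ltr_norml; apply/andP; split; lra.
have [q qP] := choice Hq.
have qE i : (\row_j q j) ord0 i = q i by rewrite mxE.
exists (\row_j q j, r) => //; rewrite asboolT.
  by move=> i /=; rewrite qE.
move=> w /= wq; apply: eU; split => // i j; rewrite (ord1 i).
have := wq j; have := qP j; rewrite qE /ball/= => vqr wqr.
rewrite (_ : v ord0 j - w ord0 j = (ratr (q j) - w ord0 j) - (ratr (q j) - v ord0 j)); last by ring.
apply: le_lt_trans (ler_normB _ _) _; lra.
Qed.

Definition consrV n (p : R * 'rV[R]_n) : 'rV[R]_n.+1 :=
  row_mx (const_mx p.1 : 'rV_1) p.2.

Lemma consrV0 n p : @consrV n p ord0 ord0 = p.1.
Proof.
have := @row_mxEl _ 1 1 n (const_mx p.1) p.2 ord0 ord0.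
by rewrite [RHS]mxE => <-; congr (row_mx _ _ _ _); exact/val_inj.
Qed.

Lemma consrVS n p i : @consrV n p ord0 (lift ord0 i) = p.2 ord0 i.
Proof.
rewrite -(@row_mxEr _ 1 1 n (const_mx p.1) p.2 ord0 i).
by congr (row_mx _ _ _ _); exact/val_inj.
Qed.

Lemma measurable_consrV n : measurable_fun [set: R * 'rV[R]_n] (@consrV n).
Proof.
apply: measurable_fun_rVP => i; case: (unliftP ord0 i) => [j ->|->].
  rewrite (_ : (fun _ => _) = (fun v : 'rV[R]_n => v ord0 j) \o snd).
    by apply: measurableT_comp => //; exact: measurable_coord.
  by apply/funext => p /=; rewrite consrVS.
rewrite (_ : (fun _ => _) = fst); first exact: measurable_fst.
by apply/funext => p /=; rewrite consrV0.
Qed.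

Definition unconsrV n (v : 'rV[R]_n.+1) : R * 'rV[R]_n :=
  (v ord0 ord0, \row_i v ord0 (lift ord0 i)).

Lemma consrVK n : cancel (@consrV n) (@unconsrV n).
Proof.
move=> [t v]; rewrite /unconsrV consrV0; congr pair => /=.
by apply/rowP => i; rewrite mxE consrVS.
Qed.

Lemma unconsrVK n : cancel (@unconsrV n) (@consrV n).
Proof.
move=> v; apply/rowP => i; case: (unliftP ord0 i) => [j ->|->].
  by rewrite consrVS mxE.
by rewrite consrV0.
Qed.

Lemma measurable_unconsrV n : measurable_fun [set: 'rV[R]_n.+1] (@unconsrV n).
Proof.
apply: measurable_fun_pair; first exact: measurable_coord.
apply: measurable_fun_rVP => i.
rewrite (_ : (fun _ => _) = fun v : 'rV[R]_n.+1 => v ord0 (lift ord0 i)).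
  exact: measurable_coord.
by apply/funext => v; rewrite mxE.
Qed.

End measurable_rV_lemmas.

Section lebesgue_rV.
Context {R : realType}.

Section step.
Variables (n : nat) (m : {sigma_finite_measure set 'rV[R]_n -> \bar R}).

Definition lebesgue_rVS : set 'rV[R]_n.+1 -> \bar R :=
  pushforward ((@lebesgue_measure R) \x m)%E (@consrV R n).

#[local] Hint Extern 0 (measurable_fun _ (@consrV _ _)) =>
  exact: measurable_consrV : core.

Let lebesgue_rVS0 : lebesgue_rVS set0 = 0%E.
Proof. exact: measure0. Qed.

Let lebesgue_rVS_ge0 A : (0 <= lebesgue_rVS A)%E.
Proof. exact: measure_ge0. Qed.

Let lebesgue_rVS_sigma_additive : semi_sigma_additive lebesgue_rVS.
Proof. exact: measure_semi_sigma_additive. Qed.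

HB.instance Definition _ := isMeasure.Build _ _ _ lebesgue_rVS
  lebesgue_rVS0 lebesgue_rVS_ge0 lebesgue_rVS_sigma_additive.

Let lebesgue_rVS_sigma_finite : sigma_finite setT lebesgue_rVS.
Proof.
have /sigma_finiteP[F [TF ndF Foo]] := sigma_finiteT (@lebesgue_measure R).
have /sigma_finiteP[G [TG ndG Goo]] := sigma_finiteT m.
exists (fun k => @unconsrV R n @^-1` (F k `*` G k)).
  apply/seteqP; split => // v _.
  have [i _ Fi] : (\bigcup_i F i) (v ord0 ord0) by rewrite -TF.
  have [j _ Gj] : (\bigcup_i G i) (unconsrV v).2 by rewrite -TG.
  exists (maxn i j) => //; split => /=.
  - by move: Fi; exact/subsetPset/ndF/leq_maxl.
  - by move: Gj; exact/subsetPset/ndG/leq_maxr.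
move=> k; have [mF Fk] := Foo k; have [mG Gk] := Goo k; split.
  by rewrite -[X in measurable X]setTI; apply: measurable_unconsrV => //;
    exact: measurableX.
rewrite /lebesgue_rVS /pushforward -comp_preimage.
rewrite (_ : _ \o _ = id) ?preimage_id; last first.
  by apply/funext => p /=; rewrite consrVK.
by rewrite product_measure1E// lte_mul_pinfty// ge0_fin_numE.
Qed.

HB.instance Definition _ := Measure_isSigmaFinite.Build _ _ _ lebesgue_rVS
  lebesgue_rVS_sigma_finite.

End step.

(* Lebesgue measure on R^n as the iterated product of the one on R; its value
   on boxes is lebesgue_rV_box. *)
Fixpoint lebesgue_rV n : {sigma_finite_measure set 'rV[R]_n -> \bar R} :=
  match n with
  | 0 => \d_(0 : 'rV[R]_0)
  | n'.+1 => lebesgue_rVS (lebesgue_rV n')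
  end.

Lemma lebesgue_rV_box n (A : 'I_n -> set R) : (forall i, measurable (A i)) ->
  lebesgue_rV n [set v | forall i, A i (v ord0 i)] =
  (\prod_(i < n) lebesgue_measure (A i))%E.
Proof.
elim: n A => [|n IH] A mA.
  by rewrite big_ord0 /= diracE mem_set// => -[].
pose B : set 'rV[R]_n := [set v | forall i, A (lift ord0 i) (v ord0 i)].
have mB : measurable B.
  rewrite (_ : B = \bigcap_(i in [set: 'I_n])
     ((fun v : 'rV[R]_n => v ord0 i) @^-1` A (lift ord0 i))); last first.
    by apply/seteqP; split => v /= H i => [_|]; apply: H.
  apply: fin_bigcap_measurable; first exact: finite_finset.
  by move=> i _; rewrite -[X in measurable X]setTI; exact: measurable_coord.
rewrite big_ord_recl -IH// -/B -product_measure1E//; last exact: mA.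
congr (product_measure1 _ _ _).
apply/seteqP; split => [p /= Ap|p /= [A0 AS] i].
  split; first by have := Ap ord0; rewrite consrV0.
  by move=> i; have := Ap (lift ord0 i); rewrite consrVS.
by case: (unliftP ord0 i) => [j ->|->]; rewrite ?consrVS ?consrV0//; exact: AS.
Qed.

End lebesgue_rV.

Section convex_bodies.
Context {R : realType} {n : nat}.
Implicit Types (x y : 'rV[R]_n) (K : set 'rV[R]_n).

Definition inner x y : R := \sum_(i < n) x ord0 i * y ord0 i.

(* The library norm on 'rV[R]_n is the sup norm; it has the same open and
   bounded sets, but not the same balls. *)
Definition enorm x : R := Num.sqrt (inner x x).

Definition euclidean_ball : set 'rV[R]_n := [set x | enorm x <= 1].

Definition convex_body K : Prop :=
  [/\ bounded_set K, open K, K !=set0 & convex_set K].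

Definition Vol K : R := fine (lebesgue_rV n K).

(* The uniform probability measure on K; the Dirac branch and the default
   argument of mnormalize are junk, for K not measurable or of measure 0 or
   +oo (see uniform_measureE). *)
Definition uniform_measure K : probability 'rV[R]_n R :=
  match pselect (measurable K) with
  | left mK => mnormalize (mrestr (lebesgue_rV n) mK) \d_(0 : 'rV[R]_n)
  | right _ => \d_(0 : 'rV[R]_n)
  end.

Lemma uniform_measureE K A : measurable K ->
  (0 < lebesgue_rV n K < +oo)%E ->
  uniform_measure K A = (lebesgue_rV n (A `&` K) * (Vol K)^-1%:E)%E.
Proof.
move=> mK /andP[K0 Koo]; rewrite /uniform_measure; case: pselect => // mK'.
by rewrite /= /mnormalize/= /mrestr setTI gt_eqF// lt_eqF.
Qed.

Definition barycenter K : 'rV[R]_n :=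
  \row_(i < n) (\int[uniform_measure K]_(y in K) y ord0 i)%R.

Definition isotropic K : Prop :=
  barycenter K = 0 /\
  forall x, (Vol K)^-1 * (\int[lebesgue_rV n]_(y in K) (inner x y ^+ 2))%R =
    enorm x ^+ 2.

Definition truncation K (s : R) : set 'rV[R]_n :=
  K `&` [set s *: x | x in euclidean_ball].

Lemma truncationE K s : 0 < s ->
  truncation K s = K `&` [set x | enorm x <= s].
Proof.
move=> s0; congr (_ `&` _).
have enormZ t x : 0 < t -> enorm (t *: x) = t * enorm x.
  move=> t0; rewrite /enorm (_ : inner _ _ = t ^+ 2 * inner x x).
    by rewrite sqrtrM ?sqr_ge0// sqrtr_sqr gtr0_norm.
  rewrite /inner mulr_sumr; apply: eq_bigr => i _.
  by rewrite mxE; ring.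
apply/seteqP; split => [_ [x x1 <-]|x /= xs] /=.
  by rewrite enormZ// ler_piMr// ltW.
exists (s^-1 *: x); last by rewrite scalerA divff ?gt_eqF// scale1r.
by rewrite /euclidean_ball/= enormZ ?invr_gt0// mulrC ler_pdivrMr// mul1r.
Qed.

Lemma measurable_truncation K s : 0 < s -> measurable K ->
  measurable (truncation K s).
Proof.
move=> s0 mK; rewrite truncationE//; apply: measurableI => //.
have mI : measurable_fun [set: 'rV[R]_n] (fun x => inner x x).
  apply: measurable_sum => i.
  by apply: measurable_funM; exact: measurable_coord.
have I0 x : 0 <= inner x x.
  by apply: sumr_ge0 => i _; rewrite -expr2 sqr_ge0.
have -> : [set x | enorm x <= s] =
    (fun x => inner x x) @^-1` [set` `]-oo, (s ^+ 2)]].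
  apply/seteqP; split => x /=; rewrite in_itv/= -[inner x x]sqr_sqrtr ?I0//;
    by rewrite ler_sqr// nnegrE ?sqrtr_ge0 ?ltW.
by rewrite -[X in measurable X]setTI; apply: mI => //; exact: measurable_itv.
Qed.

Lemma convex_body_measurable K : convex_body K -> measurable K.
Proof. by case=> _ oK _ _; exact: open_measurable_rV. Qed.

Lemma lebesgue_rV_ball x (r : R) : 0 < r ->
  lebesgue_rV n [set v | forall i, ball (x ord0 i) r (v ord0 i)] =
  ((r *+ 2) ^+ n)%:E.
Proof.
move=> r0; rewrite (@lebesgue_rV_box _ _ (fun i => ball (x ord0 i) r)).
  rewrite -[X in _ ^+ X]card_ord -prodr_const -prodEFin.
  by apply: eq_bigr => i _; rewrite lebesgue_measure_ball// ltW.
by move=> i; exact: measurable_ball.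
Qed.

Lemma lebesgue_rV_convex_body K : convex_body K ->
  (0 < lebesgue_rV n K < +oo)%E.
Proof.
move=> cK; have mK := convex_body_measurable cK.
case: cK => bK oK [x Kx] _.
have mB y (r : R) : 0 < r ->
    measurable [set v : 'rV[R]_n | forall i, ball (y ord0 i) r (v ord0 i)].
  move=> r0; apply: open_measurable_rV.
  rewrite (_ : [set v | _] = ball (y : 'rV[R]_n) r); first exact: ball_open.
  apply/seteqP; split => [v Bv|v [_ Bv] i]; last exact: Bv.
  by split => // i j; rewrite (ord1 i).
apply/andP; split.
  have /nbhs_ballP[e /= e0 eK] : nbhs x K by move: oK; rewrite openE; apply.
  apply: (@lt_le_trans _ _ ((e *+ 2) ^+ n)%:E).
    by rewrite lte_fin exprn_gt0// mulrn_wgt0.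
  rewrite -(lebesgue_rV_ball x e0); apply: le_measure; rewrite ?inE//.
    exact: mB.
  by move=> v Bv; apply: eK; split => // i j; rewrite (ord1 i).
have [M M0 KM] := pinfty_ex_gt0 bK.
have M1 : 0 < M + 1 by rewrite ltr_wpDl// ltW.
apply: (@le_lt_trans _ _ (((M + 1) *+ 2) ^+ n)%:E); last by rewrite ltry.
rewrite -(lebesgue_rV_ball 0 M1); apply: le_measure; rewrite ?inE//.
  exact: mB.
move=> v Kv i; have : ball (0 : 'rV[R]_n) (M + 1) v.
  rewrite mx_norm_ball /ball_/= sub0r normrN.
  by rewrite (le_lt_trans (KM _ Kv))// ltrDl.
by case=> _; apply.
Qed.

End convex_bodies.

(* Main.v *)
From HB Require Import structures.
Require Import Defs.
From mathcomp Require Import all_boot all_order all_algebra.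
From mathcomp Require Import all_classical all_reals all_analysis.
From mathcomp Require Import measurable_realfun.
From mathcomp Require Import ring lra.

(* Put Q = |x|^2/n - 1. Comparing the mean of |x|^2 on K_s with n for the two s
   at which K_s has relative volume 1/8 and 7/8 gives mu_K(|Q| > 7A) <= 1/4.

   It remains to bound the variance of Q by its central behaviour, with a
   constant free of n, which is Bourgain's argument for polynomials on convex
   bodies. If |Q x| > 8 k^2 delta and y is in K, then, Q being quadratic on the
   segment [y, x], one of the points at parameters 0, 1/(2k), 1/k from y lies in
   F = {|Q| > delta}. Transporting B = {|Q| > 8 k^2 delta} monotonically onto K
   (Knothe) and moving along these segments yields a multi-point form of the
   Brunn-Minkowski inequality,
     1 <= sum_i |F| / (|B|^(1 - t_i) |K|^t_i),   1 - t_i in {0, 1/(2k), 1/k},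
   whence mu_K(B) <= (3/4)^k as soon as mu_K(F) <= 1/4. Summing over k bounds
   the second moment of Q by a multiple of delta^2. The multi-point inequality
   tensorizes, so only the one-dimensional transport, by quantile functions, is
   needed. *)

Set Implicit Arguments.
Unset Strict Implicit.
Unset Printing Implicit Defensive.

Import Order.TTheory GRing.Theory Num.Theory.
Import numFieldNormedType.Exports.

Local Open Scope classical_set_scope.
Local Open Scope ring_scope.

(** * Measures on the line *)

Section weighted_measure.
Context d (T : measurableType d) (R : realType).
Variables (mu : {measure set T -> \bar R}) (w : T -> R).

(** The measure with density [w] with respect to [mu]. The proofs [mw] and [w0] are arguments so
    that the measure structure can be attached to this very term. *)
Definition weighted_measure (mw : measurable_fun setT w)
    (w0 : forall x, 0 <= w x) : set T -> \bar R :=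
  fun A => (\int[mu]_(x in A) (w x)%:E)%E.

Hypotheses (mw : measurable_fun setT w) (w0 : forall x, 0 <= w x).

Local Notation nu := (weighted_measure mw w0).

Let mEw : measurable_fun [set: T] (fun x : T => (w x)%:E).
Proof. exact/measurable_EFinP. Qed.

Let Ew0 x : (0 <= (w x)%:E)%E.
Proof. by rewrite lee_fin. Qed.

Let nu0 : nu set0 = 0%E. Proof. exact: integral_set0. Qed.

Let nu_ge0 A : (0 <= nu A)%E.
Proof. by apply: integral_ge0 => x _; exact: Ew0. Qed.

HB.instance Definition _ := isMeasure.Build _ _ _ nu nu0 nu_ge0
  (semi_sigma_additive_nng_induced mEw Ew0).

Import HBNNSimple.

Let weighted_indic E : measurable E ->
  (\int[nu]_x (\1_E x)%:E = \int[mu]_x ((\1_E x)%:E * (w x)%:E))%E.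
Proof.
move=> mE; rewrite integral_indic// setIT /= /weighted_measure.
rewrite [LHS]integral_mkcond; apply: eq_integral => x _.
by rewrite patchE indicE; case: (x \in E); rewrite ?mul1e ?mul0e.
Qed.

Let weighted_nnsfun (h : {nnsfun T >-> R}) :
  (\int[nu]_x (h x)%:E = \int[mu]_x ((h x)%:E * (w x)%:E))%E.
Proof.
under [LHS]eq_integral do rewrite fimfunE -fsumEFin//.
rewrite [LHS]ge0_integral_fsum//; last 2 first.
  - by move=> r; exact/measurable_EFinP/measurableT_comp.
  - by move=> n x _; rewrite EFinM nnfun_muleindic_ge0.
under [RHS]eq_integral.
  move=> x xD; rewrite fimfunE -fsumEFin// ge0_mule_fsuml; last first.
    by move=> r; rewrite EFinM nnfun_muleindic_ge0.
  over.
rewrite [RHS]ge0_integral_fsum//; last 2 first.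
  - move=> r; apply: emeasurable_funM => //.
    exact/measurable_EFinP/measurableT_comp.
  - by move=> n x _; rewrite mule_ge0// EFinM nnfun_muleindic_ge0.
apply: eq_fsbigr => r _.
rewrite integralZl_indic_nnsfun//= weighted_indic//.
(* A simple function [h >= 0] has empty level sets at negative [r], so both sides vanish there;
   otherwise the scalar comes out of the integral. *)
have [r0|r0] := leP 0 r; last first.
  have E0 : h @^-1` [set r] = set0 by apply: preimage_nnfun0.
  rewrite E0 [X in (_ * X)%E](_ : _ = 0)%E ?mule0; last first.
    by apply: integral0_eq => x _; rewrite indic0 mul0e.
  by apply/esym/integral0_eq => x _; rewrite indic0 mulr0 mul0e.
rewrite -ge0_integralZl_EFin//.
- by apply: eq_integral => x _; rewrite muleA.
- by move=> x _; rewrite mule_ge0// lee_fin indicE.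
- by apply: emeasurable_funM => //; exact/measurable_EFinP.
Qed.

(** Integration against a density: true for indicators by definition, for simple functions by
    linearity, in general by monotone convergence. *)
Lemma ge0_integral_weighted (f : T -> \bar R) : measurable_fun setT f ->
    (forall x, (0 <= f x)%E) ->
  (\int[nu]_x f x = \int[mu]_x (f x * (w x)%:E))%E.
Proof.
move=> mf f0; pose f_ := nnsfun_approx measurableT mf.
transitivity (limn (fun n => \int[nu]_x (f_ n x)%:E))%E.
  rewrite -monotone_convergence//=.
  - apply: eq_integral => x _; apply/esym/cvg_lim => //=.
    exact: cvg_nnsfun_approx.
  - by move=> n; apply: measurableT_comp => //; exact: measurable_funTS.
  - by move=> n x _; rewrite lee_fin.
  - by move=> x _ a b ab; rewrite lee_fin//; exact/lefP/nd_nnsfun_approx.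
under eq_fun do rewrite weighted_nnsfun.
rewrite -monotone_convergence//=.
- apply: eq_integral => x _; apply/cvg_lim => //=.
  by apply: cvgeZr => //; exact: cvg_nnsfun_approx.
- by move=> n; apply: emeasurable_funM => //; exact/measurable_EFinP.
- by move=> n x _; rewrite mule_ge0// lee_fin.
- move=> x _ a b ab; rewrite lee_wpmul2r// lee_fin//.
  exact/lefP/nd_nnsfun_approx.
Qed.

End weighted_measure.

(** Lebesgue measure is an infimum over countable covers by half-open intervals, and [nu] is
    countably subadditive along each cover. This reduces a comparison of measures to intervals. *)
Lemma le_lebesgue_measure (R : realType)
    (nu : {measure set (measurableTypeR R) -> \bar R}) :
    (forall a b : R, a <= b -> (nu `]a, b]%classic <= (b - a)%:E)%E) ->
  forall A : set (measurableTypeR R), measurable A ->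
    (nu A <= lebesgue_measure A)%E.
Proof.
move=> nuab A mA.
rewrite /lebesgue_measure/= /lebesgue_stieltjes_measure/= /measure_extension/=.
rewrite /mu_ext; apply: le_ereal_inf_tmp => _ [F [mF AF] <-].
have nuF k : (nu (F k) <= wlength idfun (F k))%E.
  have [[a b] _ <-] := mF k.
  have [ab|ba] := leP a b; last first.
    by rewrite set_itv_ge ?measure0 ?wlength0 // bnd_simp -leNgt ltW.
  by rewrite wlength_itv_bnd//; exact: nuab.
have mFk k : measurable (F k : set (measurableTypeR R)).
  by apply: sub_sigma_algebra; exact: mF.
apply: (@le_trans _ _ (\sum_(k <oo) nu (F k))%E).
  exact: measure_sigma_subadditive.
apply: lee_nneseries => // k _ _; exact: nuF.
Qed.

(** Right continuity of the distribution function: the rays ending at [y + 1/(n+1)] decrease to the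
    ray ending at [y]. *)
Lemma cdf_lt_right (R : realType) (P : probability (measurableTypeR R) R)
    (y u : R) : (P `]-oo, y]%classic < u%:E)%E ->
  exists2 y', y < y' & (P `]-oo, y']%classic < u%:E)%E.
Proof.
move=> Pyu.
pose F n := (`]-oo, (y + n.+1%:R^-1)%R]%classic : set (measurableTypeR R)).
have FE : \bigcap_n F n = `]-oo, y]%classic by rewrite -itvNycEbigcap.
have : P (F n) @[n --> \oo] --> P (\bigcap_n F n).
  apply: nonincreasing_cvg_mu => [| | |m n mn].
  - by rewrite -ge0_fin_numE// fin_num_measure//; exact: measurable_itv.
  - by move=> i; exact: measurable_itv.
  - by rewrite FE; exact: measurable_itv.
  - apply/subsetPset; apply: subset_itvl.
    by rewrite bnd_simp lerD2l lef_pV2 ?posrE// ler_nat.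
rewrite FE => /(_ [set x | x < u%:E]%E)[|N _ NP].
  by apply: open_nbhs_nbhs; split => //; exact: open_ereal_lt_ereal.
exists (y + N.+1%:R^-1); first by rewrite ltrDl.
exact: NP (leqnn N).
Qed.

(** Here [q] is the generalized inverse of the distribution function of [P], confined to [[-M, M]].
    The image under [q] of the uniform measure on [[0, 1]] agrees with [P] on rays, hence on
    half-open intervals, hence everywhere. *)
Lemma quantile_transform (R : realType) (P : probability (measurableTypeR R) R)
    (M : R) : P `[- M, M]%classic = 1%E ->
  exists q : R -> R, [/\ nondecreasing_fun q, forall u, - M <= q u <= M &
    forall A : set (measurableTypeR R), measurable A ->
      lebesgue_measure (`[0, 1]%classic `&` q @^-1` A) = P A].
Proof.
move=> PM.
have M0 : - M <= M.
  rewrite leNgt; apply/negP => MM; move: PM.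
  rewrite set_itv_ge ?measure0 ?bnd_simp -?ltNge// => /eqP.
  by rewrite eqe eq_sym oner_eq0.
(* The point [M] is added by hand so that [S u] is nonempty for every real [u], also for [u > 1];
   thus [q] is total and bounded. *)
pose S u := [set y : R | - M <= y <= M /\
  ((u%:E <= P `]-oo, y]%classic)%E \/ y = M)].
have SM u : S u M by split; [rewrite M0 lexx|right].
have Slb u : lbound (S u) (- M) by move=> y [/andP[]].
pose q u := inf (S u).
have qM u : - M <= q u <= M.
  by rewrite lb_le_inf//=; [apply: ge_inf; [exists (- M)|]|exists M].
have qnd : nondecreasing_fun q.
  move=> u v uv; apply: lb_le_inf; first by exists M.
  move=> y [yM Hy]; apply: ge_inf; first by exists (- M).
  split => //; case: Hy => [Hy|->]; last by right.
  by left; apply: le_trans Hy; rewrite lee_fin.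
(* The adjunction between [q] and the distribution function. Right continuity is what turns
   [q u <= y] into [u <= P ]-oo, y]], since the infimum need not obviously be attained. *)
have qle u y : - M <= y -> y < M ->
    (q u <= y) = (u%:E <= P `]-oo, y]%classic)%E.
  move=> My yM; apply/idP/idP => [qy|uy]; last first.
    by apply: ge_inf; [exists (- M)|split; [rewrite My ltW|left]].
  rewrite leNgt; apply/negP => /cdf_lt_right[y' yy' Py'].
  have : q u < Num.min y' M by rewrite lt_min !(le_lt_trans qy).
  move=> /inf_lt -[|s [_ Hs]]; [by exists M|rewrite lt_min => /andP[sy' sM]].
  case: Hs => [Hs|sE]; last by rewrite sE ltxx in sM.
  suff : (u%:E < u%:E)%E by rewrite ltxx.
  apply: (le_lt_trans Hs); apply: le_lt_trans Py'.
  apply: le_measure; rewrite ?inE//; apply: subset_itvl.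
  by rewrite bnd_simp ltW.
have mq : measurable_fun [set: measurableTypeR R]
    (q : measurableTypeR R -> measurableTypeR R).
  exact: nondecreasing_measurable.
have mrest : measurable (`[0%R, 1%R]%classic : set (measurableTypeR R)) by [].
pose nu_ : {measure set (measurableTypeR R) -> \bar R} :=
  pushforward (mrestr (@lebesgue_measure R) mrest)
    (q : measurableTypeR R -> measurableTypeR R).
pose nu := nu_ mq.
have nuE (A : set R) : nu A = lebesgue_measure (`[0, 1]%classic `&` q @^-1` A).
  by rewrite /nu /= /pushforward /mrestr setIC.
have nuray y : nu `]-oo, y]%classic = P `]-oo, y]%classic.
  have leb01 : lebesgue_measure (`[0, 1]%classic : set R) = 1%E.
    by rewrite lebesgue_measure_itv/= lte01 sube0.
  rewrite nuE; have [yM|My] := ltP y (- M).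
    rewrite (_ : _ `&` _ = set0) ?measure0; last first.
      rewrite -subset0 => u [_ /=]; rewrite in_itv/= => quy.
      have /andP[/le_lt_trans/(_ (le_lt_trans quy yM))] := qM u.
      by rewrite ltxx.
    have := probability_setC P (measurable_itv `[- M, M]).
    rewrite PM subee// => PC0; apply/esym/eqP.
    rewrite eq_le measure_ge0 andbT -PC0; apply: le_measure; rewrite ?inE//.
      exact: measurableC.
    move=> x /=; rewrite !in_itv/= => xy /andP[/le_trans/(_ xy)].
    by rewrite leNgt yM.
  have [yM|yM] := ltP y M; last first.
    rewrite setIidl ?leb01; last first.
      move=> u _ /=; rewrite in_itv/=; have /andP[_] := qM u.
      by move=> /le_trans; apply.
    apply/esym/eqP; rewrite eq_le probability_le1//= -PM.
    apply: le_measure; rewrite ?inE// => x /=; rewrite !in_itv/= => /andP[_].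
    by move=> /le_trans; apply.
  have Pfin : P `]-oo, y]%classic \is a fin_num by rewrite fin_num_measure.
  have P1 : fine (P `]-oo, y]%classic) <= 1.
    by rewrite -lee_fin fineK// probability_le1.
  have P0 : 0 <= fine (P `]-oo, y]%classic) by exact: fine_ge0.
  rewrite (_ : _ `&` _ = `[0, fine (P `]-oo, y]%classic)]%classic).
    rewrite lebesgue_measure_itv/= lte_fin; case: ltP => [_|P0'].
      by rewrite sube0 fineK.
    by rewrite -[RHS]fineK//; congr EFin; apply/eqP; rewrite eq_le P0 P0'.
  apply/seteqP; split => u /=;
    rewrite !in_itv/= qle// -[X in (_ <= X)%E]fineK// lee_fin.
    by move=> [/andP[-> _] ->].
  by move=> /andP[-> uP]; rewrite uP (le_trans uP).
exists q; split => // A mA; rewrite -nuE.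
(* Half-open intervals are stable under intersection and generate the Borel sets; [G] exhausts the
   line by such intervals, as uniqueness of measures requires. *)
pose G n := `](- n%:R), n%:R]%classic : set (measurableTypeR R).
apply: (@measure_unique _ R (measurableTypeR R) (@ocitv R) G erefl
  _ _ _ nu P _ _ A mA).
- exact: ocitvI.
- by move=> n; exists (- n%:R, n%:R).
- rewrite -subTset => x _; exists (Num.truncn `|x|).+1 => //.
  rewrite /G /= in_itv/=.
  by have := truncnS_gt `|x|; rewrite ltr_norml => /andP[-> /ltW ->].
- move=> _ [[a b] _ <-]; have [ab|ba] := leP a b; last first.
    by rewrite set_itv_ge ?measure0// bnd_simp -leNgt ltW.
  have -> : `]a, b]%classic = `]-oo, b] `\` `]-oo, a] :> set R.
    by rewrite -[RHS]setCK setCD setCitvl setUC -[LHS]setCK setCitv.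
  have nu_fin y : (nu `]-oo, y]%classic < +oo)%E.
    by rewrite nuray -ge0_fin_numE// fin_num_measure.
  have sub : (`]-oo, a] : set R) `<=` `]-oo, b] by exact: subset_itvl.
  have P_fin y : (P `]-oo, y]%classic < +oo)%E.
    by rewrite -ge0_fin_numE// fin_num_measure.
  rewrite !measureD//; [|exact: P_fin|exact: nu_fin].
  by rewrite setIidr//; congr (_ - _)%E; exact: nuray.
- move=> k; apply: (@le_lt_trans _ _ (nu `]-oo, k%:R]%classic)).
    apply: le_measure; rewrite ?inE; do ?exact: measurable_itv.
    by move=> x; rewrite /G /= !in_itv/= => /andP[].
  by rewrite nuray -ge0_fin_numE// fin_num_measure.
Qed.

(** The image under [z] of the measure with density [w] on [D]. Restriction to [D] is absorbed into
    the density as an indicator, so the two previous notions, density and pushforward, compose on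
    the whole space. *)
Lemma weighted_image d1 d2 (X : measurableType d1) (Y : measurableType d2)
    (R : realType) (mu : {measure set X -> \bar R})
    (D : set X) (z : X -> Y) (w : X -> R) :
    measurable D -> measurable_fun setT z -> measurable_fun setT w ->
    (forall x, 0 <= w x) ->
  exists2 nu : {measure set Y -> \bar R},
    (forall A, nu A = \int[mu]_(x in D `&` z @^-1` A) (w x)%:E)%E &
    forall f : Y -> \bar R, measurable_fun setT f -> (forall y, 0 <= f y)%E ->
      (\int[nu]_y f y = \int[mu]_(x in D) (f (z x) * (w x)%:E))%E.
Proof.
move=> mD mz mw w0.
pose wD x := w x * \1_D x.
have mwD : measurable_fun [set: X] wD by exact: measurable_funM.
have wD0 x : 0 <= wD x by rewrite mulr_ge0.
pose nu_ : {measure set Y -> \bar R} :=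
  pushforward (weighted_measure mu mwD wD0) z.
exists (nu_ mz) => [A|f mf f0].
  rewrite /nu_ /= /pushforward /weighted_measure setIC [RHS]integral_mkcondr.
  apply: eq_integral => x _.
  by rewrite patchE /wD indicE; case: (x \in D); rewrite ?mulr1 ?mulr0.
rewrite /nu_ [LHS]ge0_integral_pushforward// preimage_setT.
rewrite ge0_integral_weighted; [|exact: measurableT_comp|].
  2: by move=> x; exact: f0.
rewrite [RHS]integral_mkcond; apply: eq_integral => x _.
rewrite patchE /wD indicE.
by case: (x \in D); rewrite ?mulr1// ?mulr0 ?mule0.
Qed.

(** Domination of the image measure by [m] on sets passes to integrals of nonnegative functions. *)
Lemma ge0_integral_image_le d1 d2 (X : measurableType d1)
    (Y : measurableType d2) (R : realType) (mu : {measure set X -> \bar R})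
    (m : {measure set Y -> \bar R}) (D : set X) (z : X -> Y) (w : X -> R) :
    measurable D -> measurable_fun setT z -> measurable_fun setT w ->
    (forall x, 0 <= w x) ->
    (forall A, measurable A ->
      (\int[mu]_(x in D `&` z @^-1` A) (w x)%:E <= m A)%E) ->
  forall f : Y -> \bar R, measurable_fun setT f -> (forall y, 0 <= f y)%E ->
    (\int[mu]_(x in D) (f (z x) * (w x)%:E) <= \int[m]_y f y)%E.
Proof.
move=> mD mz mw w0 zm f mf f0.
have [nu nuE <-//] := weighted_image mu mD mz mw w0.
by apply: ge0_le_measure_integral => // A mA; rewrite nuE; exact: zm.
Qed.

Lemma measurable_funV_ge0 d (T : measurableType d) (R : realType)
    (f : T -> R) :
  measurable_fun setT f -> (forall x, 0 <= f x) ->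
  measurable_fun setT (fun x => (f x)^-1).
Proof.
move=> mf f0; under eq_fun do rewrite -powR_inv1//.
exact: (measurableT_comp (measurable_powR (-1)) mf).
Qed.

(* The density F / f (q u) is the derivative of q where f (q u) > 0; where
   f (q u) = 0, which is negligible, division gives 0. *)
Lemma quantile_density (R : realType) (f : R -> R) (M F : R) :
    measurable_fun [set: measurableTypeR R] f -> (forall x, 0 <= f x) ->
    (forall x, f x != 0 -> - M <= x <= M) ->
    (\int[lebesgue_measure]_x (f x)%:E = F%:E)%E -> 0 < F ->
  exists q : R -> R, [/\ nondecreasing_fun q, forall u, - M <= q u <= M,
    forall A : set (measurableTypeR R), measurable A ->
      (\int[lebesgue_measure]_(u in `[0%R, 1%R]%classic `&` q @^-1` A)
         (F / f (q u))%:E <= lebesgue_measure A)%E &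
    lebesgue_measure (`[0, 1]%classic `&` [set u | f (q u) = 0]) = 0%E].
Proof.
move=> mf f0 fM intf F0.
pose w x := F^-1 * f x.
have mw : measurable_fun [set: measurableTypeR R] w by exact: measurable_funM.
have w0 x : 0 <= w x by rewrite mulr_ge0// invr_ge0 ltW.
pose nu : measure _ _ := weighted_measure (@lebesgue_measure R) mw w0.
have nuT : nu setT = 1%E.
  rewrite /nu /= /weighted_measure; under eq_integral do rewrite EFinM.
  rewrite ge0_integralZl_EFin//.
  - by rewrite intf -EFinM mulVf// gt_eqF.
  - by move=> x _; rewrite lee_fin.
  - exact/measurable_EFinP.
  - by rewrite invr_ge0 ltW.
have [P PE] : exists P : probability (measurableTypeR R) R,
    forall A, P A = nu A.
  pose P : probability (measurableTypeR R) R :=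
    (HB.pack (weighted_measure (@lebesgue_measure R) mw w0)
    (Measure_isProbability.Build _ _ _ nu nuT)).
  by exists P.
have PM : P `[- M, M]%classic = 1%E.
  rewrite -nuT PE /nu /= /weighted_measure [LHS]integral_mkcond.
  apply: eq_integral => x _; rewrite patchE; case: ifPn => // /negP xM.
  have [fx|/fM fx] := eqVneq (f x) 0; first by rewrite /w fx mulr0.
  by exfalso; apply: xM; rewrite inE /= in_itv.
have [q [qnd qM qP]] := quantile_transform PM.
have mq : measurable_fun [set: measurableTypeR R]
    (q : measurableTypeR R -> measurableTypeR R).
  exact: nondecreasing_measurable.
exists q; split => //.
- move=> A mA.
  have mg : measurable_fun [set: measurableTypeR R]
      (fun y => (\1_A y * (F / f y))%:E).
    apply/measurable_EFinP; apply: measurable_funM => //.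
    apply: measurable_funM => //; exact: measurable_funV_ge0.
  have g0 y : (0 <= (\1_A y * (F / f y))%:E)%E.
    by rewrite lee_fin mulr_ge0// divr_ge0// ltW.
  (* With constant weight 1 the image under [q] is [nu]; integrating [F / f] over [A] against [nu]
     then gives the weighted image sought. *)
  have Pq (B : set (measurableTypeR R)) : measurable B ->
      (\int[lebesgue_measure]_(u in `[0%R, 1%R]%classic `&` q @^-1` B)
         (cst (1 : R) u)%:E <= nu B)%E.
    move=> mB; rewrite (eq_integral (cst 1%E))// integral_cst ?mul1e.
      by rewrite -PE -qP.
    by apply: measurableI => //; rewrite -[X in measurable X]setTI; exact: mq.
  have := @ge0_integral_image_le _ _ _ _ _ (@lebesgue_measure R) nu _ _
    (cst (1 : R)) (measurable_itv `[0, 1]) mq (measurable_cst _)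
    (fun=> ler01) Pq _ mg g0.
  rewrite (ge0_integral_weighted _ mw w0 mg g0) => gle.
  apply: le_trans (le_trans gle _).
    rewrite integral_mkcondr le_eqVlt; apply/orP; left; apply/eqP.
    apply: eq_integral => u _.
    rewrite patchE indicE -[q u \in A]/(u \in q @^-1` A) mule1.
    by case: (u \in _); rewrite ?mul1r ?mul0r.
  rewrite -[leRHS]mul1e -(integral_cst (@lebesgue_measure R) mA).
  rewrite [leRHS]integral_mkcond.
  apply: ge0_le_integral => //.
  - by move=> x _; rewrite mule_ge0// lee_fin.
  - by apply: emeasurable_funM => //; exact/measurable_EFinP.
  - by apply/(measurable_restrictT _ mA); exact: measurable_cst.
  move=> y _; rewrite patchE indicE.
  case: (y \in A); last by rewrite mul0r mul0e.
  (* The product of [F / f y] with the density [f y / F] is 1 where [f y] is nonzero and 0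
     elsewhere: this is why only an inequality holds. *)
  rewrite mul1r -EFinM lee_fin /w.
  have [->|fy] := eqVneq (f y) 0; first by rewrite invr0 !(mulr0,mul0r).
  by rewrite (_ : F / f y * (F^-1 * f y) = 1)//; field; rewrite fy gt_eqF.
- rewrite (qP [set x | f x = 0]); last first.
    by rewrite -[X in measurable X]setTI; exact: (mf measurableT [set 0]).
  rewrite PE /nu /= /weighted_measure integral0_eq// => x fx.
  by rewrite /w fx mulr0.
Qed.

(** * A one-dimensional multi-point Prekopa-Leindler inequality *)

(** The factor [c] may vanish, since it will be [1 - t] or [t] with [t] an endpoint of [[0, 1]];
    nonemptiness of [E] then still gives [0 <= B]. *)
Lemma mul_sup_le (R : realType) (E : set R) (c B : R) : E !=set0 -> 0 <= c ->
  (forall x, E x -> c * x <= B) -> c * sup E <= B.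
Proof.
move=> E0; rewrite le_eqVlt => /predU1P[<-|c0] EB.
  by have [x /EB] := E0; rewrite !mul0r.
rewrite mulrC -ler_pdivlMr//; apply: ge_sup => // x /EB.
by rewrite ler_pdivlMr// mulrC.
Qed.

Lemma mul_inf_ge (R : realType) (E : set R) (c B : R) : E !=set0 -> 0 <= c ->
  (forall x, E x -> B <= c * x) -> B <= c * inf E.
Proof.
move=> E0; rewrite le_eqVlt => /predU1P[<-|c0] EB.
  by have [x /EB] := E0; rewrite !mul0r.
rewrite mulrC -ler_pdivrMr//; apply: lb_le_inf => // x /EB.
by rewrite ler_pdivrMr// mulrC.
Qed.

(* The change of variables z = (1 - t) q1 + t q2 without differentiating: on the
   preimage of ]a, b] each q_i contributes at most its oscillation, and these
   oscillations combine to at most b - a since q1 and q2 are comonotone. *)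
Lemma interpolated_image_le (R : realType) (q1 q2 w1 w2 : R -> R) (M t : R) :
    nondecreasing_fun q1 -> nondecreasing_fun q2 ->
    (forall u, - M <= q1 u <= M) -> (forall u, - M <= q2 u <= M) ->
    measurable_fun [set: measurableTypeR R] w1 ->
    measurable_fun [set: measurableTypeR R] w2 ->
    (forall u, 0 <= w1 u) -> (forall u, 0 <= w2 u) ->
    (forall A : set (measurableTypeR R), measurable A ->
      (\int[lebesgue_measure]_(u in `[0%R, 1%R]%classic `&` q1 @^-1` A)
         (w1 u)%:E <= lebesgue_measure A)%E) ->
    (forall A : set (measurableTypeR R), measurable A ->
      (\int[lebesgue_measure]_(u in `[0%R, 1%R]%classic `&` q2 @^-1` A)
         (w2 u)%:E <= lebesgue_measure A)%E) ->
    0 <= t <= 1 ->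
  forall h : measurableTypeR R -> \bar R, measurable_fun setT h ->
    (forall y, 0 <= h y)%E ->
  (\int[lebesgue_measure]_(u in `[0%R, 1%R]) (h ((1 - t) * q1 u + t * q2 u)%R *
      ((1 - t) * w1 u + t * w2 u)%:E) <= \int[lebesgue_measure]_y h y)%E.
Proof.
move=> q1nd q2nd q1M q2M mw1 mw2 w10 w20 q1w q2w /andP[t0 t1] h mh h0.
have t1' : 0 <= 1 - t by rewrite subr_ge0.
pose z u := (1 - t) * q1 u + t * q2 u.
pose w u := (1 - t) * w1 u + t * w2 u.
have znd : nondecreasing_fun z.
  by move=> u v uv; rewrite lerD// ler_wpM2l// ?q1nd ?q2nd.
have mz : measurable_fun [set: measurableTypeR R]
    (z : measurableTypeR R -> measurableTypeR R).
  exact: nondecreasing_measurable.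
have mw : measurable_fun [set: measurableTypeR R] w.
  by apply: measurable_funD; exact: measurable_funM.
have w0 u : 0 <= w u by rewrite addr_ge0// mulr_ge0.
have m01 : measurable (`[0%R, 1%R]%classic : set (measurableTypeR R)) by [].
have [nu nuE <-//] := weighted_image (@lebesgue_measure R) m01 mz mw w0.
(* It remains to bound the image measure of a single interval []a, b]], whose preimage under [z] in
   [[0, 1]] is [J]. *)
apply: ge0_le_measure_integral => //; apply: le_lebesgue_measure => a b ab.
rewrite nuE; set J := (X in integral _ X).
have [->|/set0P[u0 Ju0]] := eqVneq J set0.
  by rewrite integral_set0 lee_fin subr_ge0.
have mJ : measurable J.
  by apply: measurableI => //; rewrite -[X in measurable X]setTI; exact: mz.
have bnd q (qM : forall u, - M <= q u <= M) :
    has_ubound (q @` J) /\ has_lbound (q @` J).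
  by split; [exists M|exists (- M)] => _ [u _ <-]; case/andP: (qM u).
have ne q : (q @` J) !=set0 by exists (q u0), u0.
(* On [J] the values of [q] lie between their infimum and supremum, so the hypothesis on the image
   of [v] bounds its integral by the length of that interval. *)
have len q (v : R -> R) : nondecreasing_fun q -> (forall u, - M <= q u <= M) ->
    measurable_fun [set: measurableTypeR R] v -> (forall u, 0 <= v u) ->
    (forall A : set (measurableTypeR R), measurable A ->
      (\int[lebesgue_measure]_(u in `[0%R, 1%R]%classic `&` q @^-1` A)
         (v u)%:E <= lebesgue_measure A)%E) ->
    (\int[lebesgue_measure]_(u in J) (v u)%:E <=
      (sup (q @` J) - inf (q @` J))%:E)%E.
  move=> qnd qM mv v0 qv; have [ub lb] := bnd q qM.
  pose I := `[inf (q @` J), sup (q @` J)]%classic : set (measurableTypeR R).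
  have mq : measurable_fun [set: measurableTypeR R]
      (q : measurableTypeR R -> measurableTypeR R).
    exact: nondecreasing_measurable.
  apply: (@le_trans _ _ (lebesgue_measure I)); last first.
    rewrite lebesgue_measure_itv/= lte_fin; case: ltP => // _.
    have Ju : (q @` J) (q u0) by exists u0.
    rewrite lee_fin subr_ge0.
    exact: le_trans (ge_inf lb Ju) (ub_le_sup ub Ju).
  have mI : measurable I by exact: measurable_itv.
  apply: le_trans (qv I mI).
  apply: ge0_subset_integral => //.
  - apply: measurableI => //.
    by have := mq measurableT I (measurable_itv _); rewrite setTI.
  - by apply/measurable_EFinP; exact: measurable_funTS.
  - by move=> u _; rewrite lee_fin.
  - move=> u Ju; split; first by case: Ju.
    rewrite /I/= in_itv/= ge_inf//=; last by exists u.
    by apply: ub_le_sup => //; exists u.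
have J1 := len _ _ q1nd q1M mw1 w10 q1w.
have J2 := len _ _ q2nd q2M mw2 w20 q2w.
apply: (@le_trans _ _ ((1 - t)%:E * (sup (q1 @` J) - inf (q1 @` J))%:E +
   t%:E * (sup (q2 @` J) - inf (q2 @` J))%:E)%E).
  rewrite /w; under eq_integral do rewrite EFinD !EFinM.
  have mE (v : R -> R) : measurable_fun [set: measurableTypeR R] v ->
      measurable_fun J (fun u => (v u)%:E).
    by move=> mv; apply/measurable_EFinP; exact: measurable_funTS.
  rewrite ge0_integralD//.
  - rewrite !ge0_integralZl_EFin//.
    + by apply: leeD; apply: lee_wpmul2l; rewrite ?lee_fin.
    + by move=> u _; rewrite lee_fin.
    + exact: mE.
    + by move=> u _; rewrite lee_fin.
    + exact: mE.
  - by move=> u _; rewrite mule_ge0// lee_fin.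
  - by apply: emeasurable_funM => //; exact: mE.
  - by move=> u _; rewrite mule_ge0// lee_fin.
  - by apply: emeasurable_funM => //; exact: mE.
rewrite -!EFinM -EFinD lee_fin.
have zJ u : J u -> a < z u <= b by case=> _ /=; rewrite in_itv.
(* With two different parameters, passing to the larger one increases both terms by monotonicity and
   stays below [b]; symmetrically, the smaller one stays above [a]. *)
have lemax u v : J u -> J v -> (1 - t) * q1 u + t * q2 v <= b.
  move=> Ju Jv; have [uv|/ltW vu] := leP u v.
    case/andP: (zJ _ Jv) => _; apply: le_trans.
    by rewrite lerD2r ler_wpM2l// q1nd.
  case/andP: (zJ _ Ju) => _; apply: le_trans.
  by rewrite lerD2l ler_wpM2l// q2nd.
have gemin u v : J u -> J v -> a <= (1 - t) * q1 u + t * q2 v.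
  move=> Ju Jv; have [uv|/ltW vu] := leP u v.
    case/andP: (zJ _ Ju) => /ltW/le_trans + _; apply.
    by rewrite lerD2l ler_wpM2l// q2nd.
  case/andP: (zJ _ Jv) => /ltW/le_trans + _; apply.
  by rewrite lerD2r ler_wpM2l// q1nd.
(* Since [u] and [v] vary independently in [lemax], the two suprema can be taken one after the
   other. *)
have sup_le : (1 - t) * sup (q1 @` J) <= b - t * sup (q2 @` J).
  apply: mul_sup_le => // _ [u Ju <-]; rewrite lerBrDl -lerBrDr.
  apply: mul_sup_le => // _ [v Jv <-]; rewrite lerBrDr addrC; exact: lemax.
have inf_ge : a - t * inf (q2 @` J) <= (1 - t) * inf (q1 @` J).
  apply: mul_inf_ge => // _ [u Ju <-]; rewrite lerBlDl -lerBlDr.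
  apply: mul_inf_ge => // _ [v Jv <-]; rewrite lerBlDr addrC; exact: gemin.
lra.
Qed.

(** Exponentiated concavity of the logarithm. *)
Lemma powR_weighted_amgm (R : realType) (a b t : R) : 0 < a -> 0 < b ->
  0 <= t <= 1 -> a `^ (1 - t) * b `^ t <= (1 - t) * a + t * b.
Proof.
move=> a0 b0 /andP[t0 t1].
have H : t * ln b + (1 - t) * ln a <= ln (t * b + (1 - t) * a) :=
  @concave_ln _ (Itv01 t0 t1) b a b0 a0.
have c0 : 0 < (1 - t) * a + t * b.
  have [->|tN0] := eqVneq t 0; first by rewrite subr0 mul1r mul0r addr0.
  by rewrite ltr_wpDl ?mulr_gt0 ?mulr_ge0 ?subr_ge0 ?(ltW a0)// lt0r tN0.
rewrite -[leRHS](@lnK R) ?posrE// /powR !gt_eqF// -expRD ler_expR.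
by rewrite addrC [leRHS](_ : _ = ln (t * b + (1 - t) * a))// addrC.
Qed.

Lemma powR_div (R : realType) (a b s : R) : 0 < a -> 0 < b ->
  (a / b) `^ s = a `^ s / b `^ s.
Proof.
move=> a0 b0; have bs : b `^ s != 0 by rewrite gt_eqF// powR_gt0.
have -> : a `^ s = (a / b) `^ s * b `^ s.
  by rewrite -powRM ?ltW ?divr_gt0// divfK// gt_eqF.
by rewrite mulfK.
Qed.

Section multi_prekopa_leindler_1d.
Context (R : realType) (k : nat) (t : 'I_k -> R) (f g : R -> R)
  (h : 'I_k -> R -> R) (M F G : R).
Hypothesis t01 : forall i, 0 <= t i <= 1.
Hypotheses (mf : measurable_fun [set: measurableTypeR R] f)
  (mg : measurable_fun [set: measurableTypeR R] g)
  (mh : forall i, measurable_fun [set: measurableTypeR R] (h i)).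
Hypotheses (f0 : forall x, 0 <= f x) (g0 : forall x, 0 <= g x)
  (h0 : forall i x, 0 <= h i x).
Hypotheses (fM : forall x, f x != 0 -> - M <= x <= M)
  (gM : forall x, g x != 0 -> - M <= x <= M).
Hypotheses (intf : (\int[lebesgue_measure]_x (f x)%:E = F%:E)%E)
  (intg : (\int[lebesgue_measure]_x (g x)%:E = G%:E)%E)
  (F0 : 0 < F) (G0 : 0 < G).
Hypothesis fgh : forall x y, 0 < f x -> 0 < g y ->
  1 <= \sum_(i < k) h i ((1 - t i) * x + t i * y) /
                    (f x `^ (1 - t i) * g y `^ (t i)).

(** Parametrize [f] and [g] by quantile functions [q1], [q2] on [[0, 1]], evaluate [fgh] at
    [(q1 u, q2 u)] and integrate in [u]. The weight [w i] plays the derivative of the interpolation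
    [z i]; the arithmetic-geometric mean inequality bounds it below and [interpolated_image_le]
    returns to the integral of [h i]. *)
Lemma multi_prekopa_leindler_1d :
  (1 <= \sum_(i < k) \int[lebesgue_measure]_x (h i x)%:E *
          ((F `^ (1 - t i) * G `^ (t i))^-1)%:E)%E.
Proof.
have [q1 [q1nd q1M q1w q10]] := quantile_density mf f0 fM intf F0.
have [q2 [q2nd q2M q2w q20]] := quantile_density mg g0 gM intg G0.
have mq1 : measurable_fun [set: measurableTypeR R]
    (q1 : measurableTypeR R -> measurableTypeR R).
  exact: nondecreasing_measurable.
have mq2 : measurable_fun [set: measurableTypeR R]
    (q2 : measurableTypeR R -> measurableTypeR R).
  exact: nondecreasing_measurable.
pose w1 u := F / f (q1 u); pose w2 u := G / g (q2 u).
have w10 u : 0 <= w1 u by rewrite divr_ge0// ltW.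
have w20 u : 0 <= w2 u by rewrite divr_ge0// ltW.
have mw1 : measurable_fun [set: measurableTypeR R] w1.
  apply: measurable_funM => //; apply: measurable_funV_ge0 => //.
  exact: (measurableT_comp mf mq1).
have mw2 : measurable_fun [set: measurableTypeR R] w2.
  apply: measurable_funM => //; apply: measurable_funV_ge0 => //.
  exact: (measurableT_comp mg mq2).
pose z i u := (1 - t i) * q1 u + t i * q2 u.
pose w i u := (1 - t i) * w1 u + t i * w2 u.
pose c i := (F `^ (1 - t i) * G `^ (t i))^-1.
have c0 i : 0 <= c i by rewrite invr_ge0 mulr_ge0// powR_ge0.
have w0 i u : 0 <= w i u.
  by have /andP[? ?] := t01 i; rewrite addr_ge0// mulr_ge0// subr_ge0.
have mw i : measurable_fun [set: measurableTypeR R] (w i).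
  by apply: measurable_funD; exact: measurable_funM.
have mz i : measurable_fun [set: measurableTypeR R]
    (z i : measurableTypeR R -> measurableTypeR R).
  by apply: measurable_funD; exact: measurable_funM.
have mhz i : measurable_fun [set: measurableTypeR R] (h i \o z i).
  exact: (measurableT_comp (mh i) (mz i)).
have m01 : measurable (`[0%R, 1%R]%classic : set (measurableTypeR R)).
  exact: measurable_itv.
have mterm i : measurable_fun (`[0%R, 1%R]%classic : set (measurableTypeR R))
    (fun u => ((h i (z i u))%:E * (w i u)%:E)%E).
  apply: measurable_funTS.
  by apply: emeasurable_funM; apply/measurable_EFinP => //; exact: mhz.
(* Intermediate quantity: the sum of the transported integrals, which the change of variables bounds
   above term by term and which is shown below to be at least 1. *)
apply: (@le_trans _ _ (\sum_(i < k) \int[lebesgue_measure]_(u in `[0%R, 1%R])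
    ((h i (z i u))%:E * (w i u)%:E) * (c i)%:E)%E); last first.
  apply: lee_sum => i _; apply: lee_wpmul2r; first by rewrite lee_fin.
  have := interpolated_image_le q1nd q2nd q1M q2M mw1 mw2 w10 w20 q1w q2w
    (t01 i).
  apply; first exact/measurable_EFinP.
  by move=> y; rewrite lee_fin.
have <- : (\int[lebesgue_measure]_(u in `[0%R, 1%R])
    \sum_(i < k) ((h i (z i u))%:E * (w i u)%:E * (c i)%:E) =
    \sum_(i < k) \int[lebesgue_measure]_(u in `[0%R, 1%R])
    ((h i (z i u))%:E * (w i u)%:E) * (c i)%:E)%E.
  rewrite ge0_integral_sum//.
  - apply: eq_bigr => i _; rewrite ge0_integralZr// ?lee_fin//.
    by move=> u _; rewrite mule_ge0// lee_fin.
  - by move=> i; apply: emeasurable_funM => //; exact: mterm.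
  - by move=> i u _; rewrite !mule_ge0// lee_fin.
have mN1 : measurable ([set u | f (q1 u) = 0] : set (measurableTypeR R)).
  have := measurableT_comp mf mq1 measurableT (measurable_set1 0).
  by rewrite setTI.
have mN2 : measurable ([set u | g (q2 u) = 0] : set (measurableTypeR R)).
  have := measurableT_comp mg mq2 measurableT (measurable_set1 0).
  by rewrite setTI.
have mI1 := measurableI _ _ m01 mN1; have mI2 := measurableI _ _ m01 mN2.
have leb01 : lebesgue_measure (`[0, 1]%classic : set R) = 1%E.
  by rewrite lebesgue_measure_itv/= lte01 sube0.
rewrite -leb01 -[leLHS]mul1e -(integral_cst _ m01).
apply: ae_ge0_le_integral => //.
- by move=> u _; apply: sume_ge0 => i _; rewrite !mule_ge0// lee_fin.
- apply: emeasurable_sum => i; apply: emeasurable_funM => //; exact: mterm.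
(* The pointwise bound needs [f (q1 u)] and [g (q2 u)] positive, which fails only on this null
   set. *)
exists (`[0, 1] `&` [set u | f (q1 u) = 0] `|`
        `[0, 1] `&` [set u | g (q2 u) = 0]).
split.
- exact: measurableU.
- by rewrite measureU0.
move=> u /= /not_implyP[u01 uN]; apply: contrapT => uNN; apply: uN.
have a0 : 0 < f (q1 u).
  by rewrite lt0r f0 andbT; apply/eqP => fu; apply: uNN; left.
have b0 : 0 < g (q2 u).
  by rewrite lt0r g0 andbT; apply/eqP => gu; apply: uNN; right.
rewrite (_ : (\sum_(i < k) _)%R = (\sum_(i < k) h i (z i u) * w i u * c i)%:E).
  rewrite lee_fin; apply: le_trans (fgh a0 b0) _; apply: ler_sum => i _.
  rewrite -/(z i u) -mulrA ler_wpM2l//.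
  (* (F / f)^(1 - t) (G / g)^t <= (1 - t) F / f + t G / g *)
  have := powR_weighted_amgm (divr_gt0 F0 a0) (divr_gt0 G0 b0) (t01 i).
  rewrite !powR_div// => le_w.
  have nz (r s : R) : 0 < r -> r `^ s != 0.
    by move=> r0; rewrite gt_eqF// powR_gt0.
  apply: le_trans (ler_wpM2r (c0 i) le_w); rewrite /c.
  rewrite le_eqVlt; apply/orP; left; apply/eqP; field.
  by rewrite !nz.
by rewrite -sumEFin.
Qed.

End multi_prekopa_leindler_1d.

(** * The multi-point Brunn-Minkowski inequality *)

Lemma lebesgue_rV_box_lty (R : realType) n (M : R) (A : set 'rV[R]_n) :
    measurable A -> (forall v, A v -> forall i, - M <= v ord0 i <= M) ->
  (lebesgue_rV n A < +oo)%E.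
Proof.
move=> mA AM.
have M1 : 0 < `|M| + 1 by rewrite ltr_wpDl.
have mB : measurable [set v : 'rV[R]_n |
    forall i, ball ((0 : 'rV[R]_n) ord0 i) (`|M| + 1) (v ord0 i)].
  apply: open_measurable_rV.
  rewrite (_ : [set v | _] = ball (0 : 'rV[R]_n) (`|M| + 1)).
    exact: ball_open.
  apply/seteqP; split => [v Bv|v [_ Bv] i]; last exact: Bv.
  by split => // i j; rewrite (ord1 i).
apply: (@le_lt_trans _ _ (((`|M| + 1) *+ 2) ^+ n)%:E); last by rewrite ltry.
rewrite -(lebesgue_rV_ball 0 M1); apply: le_measure; rewrite ?inE//.
move=> v Av i; have /andP[vl vu] := AM v Av i.
rewrite /ball/= mxE sub0r normrN.
have : `|v ord0 i| <= M by rewrite ler_norml vl vu.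
by move=> /le_lt_trans; apply; rewrite (le_lt_trans (ler_norm M))// ltrDl.
Qed.

Lemma lebesgue_rV_xsection (R : realType) n (A : set 'rV[R]_n.+1) :
  lebesgue_rV n.+1 A =
  (\int[lebesgue_measure]_a lebesgue_rV n [set v | A (consrV (a, v))])%E.
Proof.
rewrite /= /lebesgue_rVS /pushforward /product_measure1.
apply: eq_integral => a _ /=; congr (lebesgue_rV n _).
by apply/seteqP; split => v; rewrite /xsection /= inE.
Qed.

Lemma measurable_rV_section (R : realType) n (A : set 'rV[R]_n.+1) (a : R) :
  measurable A -> measurable [set v | A (consrV (a, v))].
Proof.
move=> mA; have := measurable_consrV measurableT mA; rewrite setTI => mA'.
have := measurable_xsection a mA'.
rewrite (_ : xsection _ _ = [set v | A (consrV (a, v))])//.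
by apply/seteqP; split => v; rewrite /xsection /= inE.
Qed.

Lemma measurable_lebesgue_rV_section (R : realType) n (A : set 'rV[R]_n.+1) :
  measurable A -> measurable_fun [set: measurableTypeR R]
    (fun a => lebesgue_rV n [set v | A (consrV (a, v))]).
Proof.
move=> mA; have := measurable_consrV measurableT mA; rewrite setTI => mA'.
have := measurable_fun_xsection (lebesgue_rV n) mA'.
apply: eq_measurable_fun => a _; congr (lebesgue_rV n _).
by apply/seteqP; split => v; rewrite /xsection /= inE.
Qed.

Lemma consrV_comb (R : realType) n (s t x y : R) (v w : 'rV[R]_n) :
  consrV (s * x + t * y, s *: v + t *: w) =
  s *: consrV (x, v) + t *: consrV (y, w).
Proof.
apply/rowP => i; rewrite [RHS]mxE [X in _ = X + _]mxE [X in _ = _ + X]mxE.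
case: (unliftP ord0 i) => [j ->|->].
  by rewrite !consrVS !mxE.
by rewrite !consrV0.
Qed.

Lemma lebesgue_rV0 (R : realType) (A : set 'rV[R]_0) :
  A 0 -> lebesgue_rV 0 A = 1%E.
Proof. by move=> A0; rewrite /= diracE mem_set. Qed.

(** Induction on the dimension by slicing along the first coordinate: the volumes of the sections
    satisfy the one-dimensional inequality. The index [i] may depend on the pair [(x, y)], which is
    what a quadratic requires: different segments meet the large-value set at different
    parameters. *)
Lemma multi_brunn_minkowski (R : realType) (k : nat) (t : 'I_k -> R) (M : R) n
    (B K : set 'rV[R]_n) (S : 'I_k -> set 'rV[R]_n) :
  (forall i, 0 <= t i <= 1) ->
  measurable B -> measurable K -> (forall i, measurable (S i)) ->
  (forall v, B v -> forall i, - M <= v ord0 i <= M) ->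
  (forall v, K v -> forall i, - M <= v ord0 i <= M) ->
  (forall j v, S j v -> forall i, - M <= v ord0 i <= M) ->
  (forall x y, B x -> K y -> exists i, S i ((1 - t i) *: x + t i *: y)) ->
  (0 < lebesgue_rV n B)%E -> (0 < lebesgue_rV n K)%E ->
  (1 <= \sum_(i < k) lebesgue_rV n (S i) *
    ((fine (lebesgue_rV n B) `^ (1 - t i) *
      fine (lebesgue_rV n K) `^ (t i))^-1)%:E)%E.
Proof.
move=> t01; elim: n B K S => [|n IH] B K S mB mK mS BM KM SM BKS B0 K0.
  (* In dimension 0 positive measure means containing the only point; some [S i] then contains it
     too, and its term alone equals 1. *)
  have B00 : B 0.
    by apply: contrapT => B00; move: B0; rewrite /= diracE memNset// ltxx.
  have K00 : K 0.
    by apply: contrapT => K00; move: K0; rewrite /= diracE memNset// ltxx.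
  have [i] := BKS _ _ B00 K00; rewrite !scaler0 addr0 => Si.
  rewrite !lebesgue_rV0// (bigD1 i)//= lebesgue_rV0// !powR1 mulr1 invr1 mule1.
  rewrite leeDl//; apply: sume_ge0 => j _; exact: mule_ge0.
pose sec (A : set 'rV[R]_n.+1) a := [set v | A (consrV (a, v))].
have secM (A : set 'rV[R]_n.+1) a :
    (forall v, A v -> forall i, - M <= v ord0 i <= M) ->
    forall v, sec A a v -> forall i, - M <= v ord0 i <= M.
  by move=> AM v Av i; have := AM _ Av (lift ord0 i); rewrite consrVS.
have secfin (A : set 'rV[R]_n.+1) a : measurable A ->
    (forall v, A v -> forall i, - M <= v ord0 i <= M) ->
    lebesgue_rV n (sec A a) \is a fin_num.
  move=> mA AM; rewrite ge0_fin_numE//.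
  apply: (@lebesgue_rV_box_lty _ _ M); first exact: measurable_rV_section.
  exact: secM.
(* Volume of a section. For a measurable set in the box of half-side [M] it is finite, so [fine]
   loses nothing, and it vanishes for [a] outside [[-M, M]]. *)
pose f (A : set 'rV[R]_n.+1) a := fine (lebesgue_rV n (sec A a)).
have mf A : measurable A -> measurable_fun [set: measurableTypeR R] (f A).
  move=> mA; apply: measurableT_comp => //.
  exact: measurable_lebesgue_rV_section.
have f0 A a : 0 <= f A a by exact: fine_ge0.
have fM (A : set 'rV[R]_n.+1) : measurable A ->
    (forall v, A v -> forall i, - M <= v ord0 i <= M) ->
    forall a, f A a != 0 -> - M <= a <= M.
  move=> mA AM a; apply: contraNT => aM.
  rewrite /f (_ : sec A a = set0) ?measure0// -subset0 => v Av.
  by move/negP: aM; apply; have := AM _ Av ord0; rewrite consrV0.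
have intf (A : set 'rV[R]_n.+1) : measurable A ->
    (forall v, A v -> forall i, - M <= v ord0 i <= M) ->
    (\int[lebesgue_measure]_a (f A a)%:E = lebesgue_rV n.+1 A)%E.
  move=> mA AM; rewrite lebesgue_rV_xsection; apply: eq_integral => a _.
  by rewrite fineK//; exact: secfin.
have finA (A : set 'rV[R]_n.+1) : measurable A ->
    (forall v, A v -> forall i, - M <= v ord0 i <= M) ->
    lebesgue_rV n.+1 A \is a fin_num.
  by move=> mA AM; rewrite ge0_fin_numE//; exact: (lebesgue_rV_box_lty mA AM).
have := @multi_prekopa_leindler_1d R k t (f B) (f K) (fun i => f (S i)) M
  (fine (lebesgue_rV n.+1 B)) (fine (lebesgue_rV n.+1 K)) t01
  (mf _ mB) (mf _ mK) (fun i => mf _ (mS i)) (f0 B) (f0 K) (fun i => f0 (S i))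
  (fM _ mB BM) (fM _ mK KM).
rewrite !intf// !fineK ?finA// => H.
under eq_bigr => i _ do rewrite -(intf _ (mS i) (SM i)).
apply: H => //.
- by apply: fine_gt0; rewrite B0 -ge0_fin_numE// finA.
- by apply: fine_gt0; rewrite K0 -ge0_fin_numE// finA.
(* Sections of [B] over [x] and of [K] over [y] combine into the section of [S i] over
   [(1 - t i) * x + t i * y]; the induction hypothesis for them is the pointwise assumption on [f],
   [g], [h]. *)
move=> x y fx gy.
have := IH (sec B x) (sec K y) (fun i => sec (S i) ((1 - t i) * x + t i * y)).
have pos (A : set 'rV[R]_n.+1) a : 0 < f A a -> (0 < lebesgue_rV n (sec A a))%E.
  rewrite /f => fa; rewrite lt0e measure_ge0 andbT.
  by apply: contraTneq fa => ->; rewrite ltxx.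
move=> /(_ (measurable_rV_section x mB) (measurable_rV_section y mK)
  (fun i => measurable_rV_section _ (mS i)) (secM _ _ BM) (secM _ _ KM)
  (fun i => secM _ _ (SM i))).
move=> H1.
rewrite -lee_fin -sumEFin; apply: le_trans (H1 _ (pos _ _ fx) (pos _ _ gy)) _.
  move=> v w Bv Kw; have [i Si] := BKS _ _ Bv Kw; exists i.
  by rewrite /sec /= consrV_comb.
apply: lee_sum => i _; rewrite EFinM /f fineK//.
by apply: secfin => //; exact: SM.
Qed.

(** * Tails of a quadratic on a convex body *)

Lemma inner_comb (R : realType) n (x y : 'rV[R]_n) (a b : R) :
  inner (a *: x + b *: y) (a *: x + b *: y) =
  a ^+ 2 * inner x x + 2 * a * b * inner x y + b ^+ 2 * inner y y.
Proof.
rewrite /inner !mulr_sumr -!big_split; apply: eq_bigr => i _.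
by rewrite !mxE /=; ring.
Qed.

Lemma measurable_inner (R : realType) n :
  measurable_fun [set: 'rV[R]_n] (fun x => inner x x).
Proof.
by apply: measurable_sum => i; apply: measurable_funM; exact: measurable_coord.
Qed.

(* Lagrange interpolation of a quadratic on the segment [y, x] from its values
   at 0, 1/(2k), 1/k, evaluated at 1. *)
Lemma quadratic_extrapolation (R : realType) n (x y : 'rV[R]_n) (c delta : R)
    (k : nat) (Q := fun z => c * inner z z - 1) : (0 < k)%N ->
  (forall i : 'I_3, let s := i%:R / 2 / k%:R in
    `|Q (s *: x + (1 - s) *: y)| <= delta) ->
  `|Q x| <= 8 * k%:R ^+ 2 * delta.
Proof.
move=> k0 H; have k1 : (1 : R) <= k%:R by rewrite ler1n.
have kN0 : (k%:R : R) != 0 by rewrite pnatr_eq0 -lt0n.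
have H0 := H (inord 0); have H1 := H (inord 1); have H2 := H (inord 2).
move: H0 H1 H2; rewrite /Q /= !inordK//.
rewrite !inner_comb.
set X := inner x x; set Y := inner y y; set Z := inner x y.
set q0 := (X in `|X|); set q1 := (X in _ -> `|X| <= _ -> _).
set q2 := (X in _ -> _ -> `|X| <= _ -> _).
move=> /ler_normlP[H01 H02] /ler_normlP[H11 H12] /ler_normlP[H21 H22].
set K := k%:R in k1 kN0 *.
(* The Lagrange coefficients at 1; their absolute values sum to [8 K^2 - 8 K + 1], whence the factor
   [8 k^2]. *)
have -> : c * X - 1 = (2 * K - 1) * (K - 1) * q0 - 4 * K * (K - 1) * q1 +
    K * (2 * K - 1) * q2.
  by rewrite /q0 /q1 /q2 -/K; field.
have a0 : 0 <= (2 * K - 1) * (K - 1) by nra.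
have a1 : 0 <= 4 * K * (K - 1) by nra.
have a2 : 0 <= K * (2 * K - 1) by nra.
have d0 : 0 <= delta by lra.
rewrite ler_norml; apply/andP; split; nra.
Qed.

Lemma bounded_set_coord (R : realType) n (K : set 'rV[R]_n) : bounded_set K ->
  exists M : R, forall v, K v -> forall i, - M <= v ord0 i <= M.
Proof.
move=> bK; have [M M0 KM] := pinfty_ex_gt0 bK.
exists (M + 1) => v Kv i; have : ball (0 : 'rV[R]_n) (M + 1) v.
  by rewrite mx_norm_ball /ball_/= sub0r normrN (le_lt_trans (KM _ Kv))// ltrDl.
case=> _ /(_ ord0 i); rewrite /ball/= mxE sub0r normrN => /ltW.
by rewrite ler_norml.
Qed.

Lemma convex_setE (R : realType) n (K : set 'rV[R]_n) (x y : 'rV[R]_n) (s : R) :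
  convex_set K -> K x -> K y -> 0 <= s <= 1 -> K (s *: x + (1 - s) *: y).
Proof.
move=> cK Kx Ky /andP[s0 s1].
have := cK x y (Itv01 s0 s1); rewrite !inE => h; exact: h.
Qed.

Lemma measurable_quadratic (R : realType) n (c : R) :
  measurable_fun [set: 'rV[R]_n] (fun x => c * inner x x - 1).
Proof.
apply: measurable_funB => //; apply: measurable_funM => //.
exact: measurable_inner.
Qed.

Lemma measurable_quadratic_gt (R : realType) n (c d : R) :
  measurable [set x : 'rV[R]_n | d < `|c * inner x x - 1|].
Proof.
have mQ := measurableT_comp (@normr_measurable R setT)
  (@measurable_quadratic R n c).
have := mQ measurableT _ (measurable_itv `]d, +oo[); rewrite setTI.
rewrite (_ : _ @^-1` _ = [set x : 'rV[R]_n | d < `|c * inner x x - 1|])//.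
by apply/seteqP; split => x /=; rewrite in_itv/= andbT.
Qed.

(** Put [p = |B| / |K|]. Each of the three denominators [|B|^(s i) |K|^(1 - s i)] equals
    [|K| p^(s i)], at least [|K| p^(1/k)] because [s i <= 1/k]. Hence
    [p^(1/k) <= 3 |F| / |K| <= 3/4]. *)
Lemma quadratic_tail (R : realType) n (K : set 'rV[R]_n) (c delta : R) (k : nat)
    (F := fun d => K `&` [set x | d < `|c * inner x x - 1|]) :
  convex_body K -> (4%:E * lebesgue_rV n (F delta) <= lebesgue_rV n K)%E ->
  (lebesgue_rV n (F (8 * k%:R ^+ 2 * delta)%R) <=
   ((3 / 4) ^+ k)%:E * lebesgue_rV n K)%E.
Proof.
move=> cK Fle; have mK := convex_body_measurable cK.
have /andP[K0 Koo] := lebesgue_rV_convex_body cK.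
have mF d : measurable (F d).
  by apply: measurableI => //; exact: measurable_quadratic_gt.
have FK d : (lebesgue_rV n (F d) <= lebesgue_rV n K)%E.
  by apply: le_measure; rewrite ?inE//; exact: subIsetl.
have [->|k0] := posnP k; first by rewrite expr0 mul1e FK.
have [bK oK _ cvK] := cK; have [M KM] := bounded_set_coord bK.
set B := F _.
have [->|B0] := eqVneq (lebesgue_rV n B) 0%E.
  by rewrite mule_ge0// lee_fin exprn_ge0.
have kR1 : (1 : R) <= k%:R by rewrite ler1n.
pose s (i : 'I_3) : R := i%:R / 2 / k%:R.
have s01 i : 0 <= s i <= k%:R^-1.
  rewrite /s !divr_ge0//= ler_pdivrMr ?(lt_le_trans _ kR1)//.
  rewrite mulVf ?pnatr_eq0 -?lt0n//.
  by rewrite ler_pdivrMr// mul1r ler_nat -ltnS.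
have s1 i : s i <= 1.
  have /andP[_ h] := s01 i; apply: le_trans h _.
  by rewrite invf_le1 // (lt_le_trans _ kR1).
have t01 i : 0 <= 1 - s i <= 1.
  by have /andP[si0 _] := s01 i; rewrite subr_ge0 s1 gerBl.
(* Contrapositive of the extrapolation: were all three points of the segment outside [F delta],
   convexity keeping them in [K], then [x] could not be in [B]. *)
have BKF x y : B x -> K y ->
    exists i, F delta ((1 - (1 - s i)) *: x + (1 - s i) *: y).
  move=> [Kx Bx] Ky; apply: contrapT => /forallNP nF.
  move: Bx; rewrite /= ltNge => /negP; apply.
  apply: (quadratic_extrapolation k0 (y := y)) => i.
  rewrite /= -/(s i) leNgt.
  apply/negP => Qi; apply: (nF i); rewrite subKr; split => //.
  by apply: convex_setE => //; rewrite s1 andbT; have /andP[] := s01 i.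
have BB : (0 < lebesgue_rV n B)%E by rewrite lt0e B0 measure_ge0.
have := multi_brunn_minkowski t01 (mF _) mK (fun=> mF delta)
  (fun v Bv => KM v Bv.1) KM (fun _ v Fv => KM v Fv.1) BKF BB K0.
have fin d : lebesgue_rV n (F d) \is a fin_num.
  by rewrite ge0_fin_numE// (le_lt_trans (FK _)).
have Kfin : lebesgue_rV n K \is a fin_num by rewrite ge0_fin_numE.
move: Fle (FK (8 * k%:R ^+ 2 * delta)) BB K0; rewrite -/B.
rewrite -[lebesgue_rV n B](fineK (fin _)) -[lebesgue_rV n K](fineK Kfin).
rewrite -[lebesgue_rV n (F delta)](fineK (fin _)) /=.
set b := fine (lebesgue_rV n B); set v := fine (lebesgue_rV n K).
set f := fine (lebesgue_rV n (F delta)).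
rewrite -!EFinM !lee_fin !lte_fin => fv bv b0 v0.
under eq_bigr do rewrite -EFinM; rewrite sumEFin lee_fin => H.
have f0 : 0 <= f by exact: fine_ge0.
pose p := b / v.
have p01 : 0 < p <= 1 by rewrite /p divr_gt0//= ler_pdivrMr// mul1r.
have /andP[p0 p1] := p01.
pose r := p `^ k%:R^-1.
have r0 : 0 < r by exact: powR_gt0.
have pE : p = r ^+ k.
  rewrite -powR_mulrn ?powR_ge0// -powRrM mulVf ?powRr1 ?(ltW p0)//.
  by rewrite pnatr_eq0 -lt0n.
suff : r <= 3 / 4.
  rewrite -(@ler_pdivrMr _ v)// -/p pE => r34; apply: lerXn2r => //.
    by rewrite nnegrE ltW.
  by rewrite nnegrE.
have : 1 <= \sum_(i < 3) (f / v / r).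
  apply: le_trans H _; apply: ler_sum => i _; rewrite subKr -mulrA.
  apply: ler_wpM2l => //; rewrite -invfM lef_pV2 ?posrE ?mulr_gt0 ?powR_gt0//.
  have -> : b `^ s i * v `^ (1 - s i) = v * p `^ s i.
    have bE : b = p * v by rewrite divfK// gt_eqF.
    rewrite {1}bE powRM ?ltW// -mulrA -powRD; last first.
      by apply/implyP => _; rewrite gt_eqF.
    by rewrite addrC subrK powRr1 ?ltW// mulrC.
  apply: ler_wpM2l; first exact: ltW.
  by apply: ger_powR => //; have /andP[] := s01 i.
rewrite sumr_const card_ord -mulr_natl => r3.
have : f / v <= 4^-1 by rewrite ler_pdivrMr// mulrC ler_pdivlMr// mulrC.
have : f / v / r * r = f / v by rewrite divfK// gt_eqF.
nra.
Qed.

(* The potential 200 (k + 14)^4 (3/4)^k decreases by at least the k-th term. *)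
Lemma quartic_geometric_sum (R : realType) (N : nat) :
  \sum_(k < N) k.+1%:R ^+ 4 * (3 / 4) ^+ k <= 200 * 14 ^+ 4 :> R.
Proof.
suff : \sum_(k < N) k.+1%:R ^+ 4 * (3 / 4) ^+ k +
    200 * (N%:R + 14) ^+ 4 * (3 / 4) ^+ N <= 200 * 14 ^+ 4 :> R.
  apply: le_trans; rewrite lerDl mulr_ge0//.
elim: N => [|N IH]; first by rewrite big_ord0 !add0r expr0 mulr1.
rewrite big_ord_recr /=; apply: le_trans IH.
rewrite -addrA lerD2l [(3 / 4) ^+ N.+1]exprSr -natr1.
set n : R := N%:R; set q : R := (3 / 4) ^+ N.
have n0 : 0 <= n by [].
have q0 : 0 <= q by exact: exprn_ge0.
pose y := n + 14; have y14 : 14 <= y by rewrite lerDr.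
rewrite -[n + 1 + 14](_ : y + 1 = _); last by rewrite /y addrAC.
rewrite -/y.
(* For [y >= 14] one has [(15/14)^2 <= 23/20], so one step multiplies the potential by at most
   [529/400 * 3/4 = 1587/1600]. The gain [200 * 13/1600 = 13/8] exceeds 1 and pays for the new
   term. *)
have Z23 : (y + 1) ^+ 2 <= 23 / 20 * y ^+ 2 by nra.
have W1 : (n + 1) ^+ 2 <= y ^+ 2 by rewrite /y; nra.
have Z0 : 0 <= (y + 1) ^+ 2 by exact: sqr_ge0.
have W0 : 0 <= (n + 1) ^+ 2 by exact: sqr_ge0.
rewrite -![_ ^+ 4]/(_ ^+ (2 * 2)) !exprM.
move: Z23 W1 Z0 W0.
set Y := y ^+ 2; set Z := (y + 1) ^+ 2; set W := (n + 1) ^+ 2 => Z23 W1 Z0 W0.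
have ZZ : Z ^+ 2 <= 529 / 400 * Y ^+ 2 by nra.
have WW : W ^+ 2 <= Y ^+ 2 by nra.
rewrite (_ : _ + _ = (W ^+ 2 + 200 * Z ^+ 2 * (3 / 4)) * q); last by field.
apply: ler_wpM2r => //.
have := sqr_ge0 Y; lra.
Qed.

(** The term of the last level exceeded suffices: if [|q|] lies between levels [k] and [k + 1], then
    [q^2] is at most the square of level [k + 1], that is [64 delta^2 (k + 1)^4]. *)
Lemma sqr_le_sum_levels (R : realType) (q delta : R) (N : nat) : 0 <= delta ->
  `|q| <= 8 * N%:R ^+ 2 * delta ->
  q ^+ 2 <= \sum_(k < N) 64 * delta ^+ 2 * k.+1%:R ^+ 4 *
    (8 * k%:R ^+ 2 * delta < `|q|)%R%:R.
Proof.
move=> d0; elim: N => [|N IH] qN.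
  have : `|q| <= 0 by move: qN; rewrite expr0n mulr0 mul0r.
  by rewrite normr_le0 => /eqP ->; rewrite big_ord0 expr0n.
rewrite big_ord_recr /=; have [qN'|qN'] := leP `|q| (8 * N%:R ^+ 2 * delta).
  by rewrite mulr0 addr0 IH.
rewrite mulr1 ler_wpDl//.
  apply: sumr_ge0 => k _; rewrite !mulr_ge0// ?sqr_ge0 ?exprn_ge0//.
rewrite -real_normK ?num_real//.
apply: (@le_trans _ _ ((8 * N.+1%:R ^+ 2 * delta) ^+ 2)).
  by rewrite lerXn2r// nnegrE !mulr_ge0// exprn_ge0.
by rewrite le_eqVlt; apply/orP; left; apply/eqP; ring.
Qed.

Lemma quadratic_bounded (R : realType) n (K : set 'rV[R]_n) (c : R) :
  bounded_set K -> exists M : R, forall x, K x -> `|c * inner x x - 1| <= M.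
Proof.
move=> /bounded_set_coord[M KM].
exists (`|c| * \sum_(i < n) M ^+ 2 + 1) => x Kx.
apply: le_trans (ler_normB _ _) _; rewrite normr1 lerD2r normrM ler_wpM2l//.
rewrite ger0_norm; last by apply: sumr_ge0 => i _; rewrite -expr2 sqr_ge0.
apply: ler_sum => i _; have := KM _ Kx i; rewrite -expr2 => /andP[? ?].
rewrite -[leLHS]real_normK ?num_real// -[leRHS]real_normK ?num_real//.
rewrite lerXn2r// ?nnegrE//; apply: le_trans (ler_norm M).
by rewrite ler_norml; apply/andP.
Qed.

(** Integrate the decomposition into levels and insert the tail bound [(3/4)^k]; the resulting
    series is the quartic geometric sum. *)
Lemma quadratic_second_moment (R : realType) n (K : set 'rV[R]_n) (c delta : R)
    (F := fun d => K `&` [set x | d < `|c * inner x x - 1|]) :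
  convex_body K -> 0 < delta ->
  (4%:E * lebesgue_rV n (F delta) <= lebesgue_rV n K)%E ->
  (\int[lebesgue_rV n]_(x in K) ((c * inner x x - 1) ^+ 2)%:E <=
   (64 * delta ^+ 2 * (200 * 14 ^+ 4))%:E * lebesgue_rV n K)%E.
Proof.
move=> cK d0 Fle; have mK := convex_body_measurable cK.
have [bK _ _ _] := cK.
have [M QM] := quadratic_bounded c bK.
have mF d : measurable (F d).
  by apply: measurableI => //; exact: measurable_quadratic_gt.
have c0 (k : nat) : 0 <= 64 * delta ^+ 2 * k.+1%:R ^+ 4.
  by apply: mulr_ge0; rewrite ?exprn_ge0// mulr_ge0// sqr_ge0.
(* Enough levels to cover the values of the quadratic on [K], as [M <= N delta <= 8 N^2 delta]. [N]
   depends on [K], the final bound does not. *)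
pose N := (Num.truncn (M / delta)).+1.
have QN x : K x -> `|c * inner x x - 1| <= 8 * N%:R ^+ 2 * delta.
  move=> /QM /le_trans; apply.
  have : M / delta < N%:R by exact: truncnS_gt.
  rewrite ltr_pdivrMr// => /ltW/le_trans; apply.
  rewrite ler_wpM2r ?ltW//.
  have : (1 : R) <= N%:R by rewrite ler1n.
  nra.
apply: (@le_trans _ _ (\int[lebesgue_rV n]_(x in K)
    (\sum_(k < N) (64 * delta ^+ 2 * k.+1%:R ^+ 4)%:E *
      (\1_(F (8 * k%:R ^+ 2 * delta)%R) x)%:E))%E).
  apply: ge0_le_integral => //.
  - by move=> x _; rewrite lee_fin sqr_ge0.
  - apply/measurable_EFinP; apply: measurable_funX; apply: measurable_funTS.
    exact: measurable_quadratic.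
  - apply: emeasurable_sum => k; apply: emeasurable_funM => //.
    by apply/measurable_EFinP; exact: measurable_indic.
  - move=> x Kx.
    under eq_bigr do rewrite -EFinM; rewrite sumEFin lee_fin.
    apply: le_trans (sqr_le_sum_levels (ltW d0) (QN _ Kx)) _.
    apply: ler_sum => k _; apply: ler_wpM2l; first exact: c0.
    case: ltP => // Qk.
    by rewrite indicE mem_set.
have mI d : measurable_fun K (fun x => (\1_(F d) x)%:E).
  by apply/measurable_EFinP; exact: measurable_indic.
rewrite ge0_integral_sum//; last 2 first.
  - by move=> k; exact: emeasurable_funM.
  - by move=> k x _; rewrite mule_ge0// lee_fin.
have intF d : (\int[lebesgue_rV n]_(x in K) (\1_(F d) x)%:E =
    lebesgue_rV n (F d))%E.
  by rewrite integral_indic// setIC setIA setIid.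
apply: (@le_trans _ _ (\sum_(k < N) (64 * delta ^+ 2 * k.+1%:R ^+ 4)%:E *
    (((3 / 4) ^+ k)%:E * lebesgue_rV n K))%E).
  apply: lee_sum => k _; rewrite ge0_integralZl_EFin//.
  rewrite intF; apply: lee_wpmul2l; first by rewrite lee_fin.
  exact: quadratic_tail.
under eq_bigr do rewrite muleA -EFinM.
rewrite -ge0_sume_distrl; last first.
  by move=> k _; rewrite lee_fin mulr_ge0// exprn_ge0.
rewrite sumEFin; apply: lee_wpmul2r => //; rewrite lee_fin.
under eq_bigr do rewrite -[_ * _ ^+ 4 * _]mulrA.
rewrite -mulr_sumr; apply: ler_wpM2l; first by rewrite mulr_ge0// sqr_ge0.
exact: quartic_geometric_sum.
Qed.

(** * Truncations of isotropic bodies *)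

(** Sections of a sphere are spheres of one dimension less, down to dimension 1, where there are at
    most two points. Positive dimension is essential: in dimension 0 the case [r = 0] is the whole
    space. *)
Lemma lebesgue_rV_sphere (R : realType) n (r : R) :
  lebesgue_rV n.+1 [set x | inner x x = r] = 0%E.
Proof.
have innerC m a (v : 'rV[R]_m) :
    inner (consrV (a, v)) (consrV (a, v)) = a ^+ 2 + inner v v.
  rewrite /inner big_ord_recl consrV0 -expr2; congr (_ + _).
  by apply: eq_bigr => i _; rewrite !consrVS.
elim: n r => [|n IH] r; rewrite lebesgue_rV_xsection; last first.
  apply: integral0_eq => a _; rewrite -[RHS](IH (r - a ^+ 2)).
  congr (lebesgue_rV _ _); apply/seteqP; split => v /=; rewrite innerC.
    by move=> <-; rewrite addrC addKr.
  by move=> ->; rewrite addrC subrK.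
pose N := [set a : R | a ^+ 2 = r].
have -> : (\int[lebesgue_measure]_a
    lebesgue_rV 0 [set v | inner (consrV (a, v)) (consrV (a, v)) = r] =
    \int[lebesgue_measure]_(a in (setT : set R)) (\1_N a)%:E)%E.
  apply: eq_integral => a _; rewrite indicE.
  have inner0 (v : 'rV[R]_0) : inner v v = 0 by rewrite /inner big_ord0.
  have [ar|ar] := pselect (a ^+ 2 = r).
    rewrite lebesgue_rV0 /= ?innerC ?inner0 ?addr0// mem_set//.
  rewrite memNset// (_ : [set v | _] = set0) ?measure0//.
  by rewrite -subset0 => v /=; rewrite innerC inner0 addr0.
have NE : N `<=` [set Num.sqrt r; - Num.sqrt r].
  move=> a /= <-; rewrite sqrtr_sqr; have [a0|a0] := leP 0 a; [left|right].
    by rewrite ger0_norm.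
  by rewrite ltr0_norm// opprK.
have cN : countable N.
  by apply: finite_set_countable; exact: sub_finite_set NE (finite_set2 _ _).
have mN : measurable (N : set (measurableTypeR R)).
  by apply: countable_measurable => //.
rewrite integral_indic// setIT; exact: countable_lebesgue_measure0.
Qed.

Lemma enorm_sqr (R : realType) n (x : 'rV[R]_n) : enorm x ^+ 2 = inner x x.
Proof.
by rewrite sqr_sqrtr// sumr_ge0// => i _; rewrite -expr2 sqr_ge0.
Qed.

Lemma inner_ge0 (R : realType) n (x : 'rV[R]_n) : 0 <= inner x x.
Proof. by rewrite -enorm_sqr sqr_ge0. Qed.

Lemma integral_uniform_measure (R : realType) n (K : set 'rV[R]_n)
    (f : 'rV[R]_n -> R) : measurable K -> (0 < lebesgue_rV n K < +oo)%E ->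
    measurable_fun setT f -> (forall x, 0 <= f x) ->
  (\int[uniform_measure K]_(x in K) (f x)%:E =
   ((Vol K)^-1)%:E * \int[lebesgue_rV n]_(x in K) (f x)%:E)%E.
Proof.
move=> mK K0oo mf f0.
have V0 : 0 <= (Vol K)^-1 by rewrite invr_ge0 fine_ge0.
rewrite (eq_measure_integral (mscale (NngNum V0) (lebesgue_rV n))).
  rewrite ge0_integral_mscale//.
  - by apply/measurable_EFinP; exact: measurable_funTS.
  - by move=> x _; rewrite lee_fin.
move=> A mA AK; rewrite [LHS]uniform_measureE// setIidl//.
by rewrite /mscale /= muleC.
Qed.

(** The value [q alpha] works: monotonicity places [[0, alpha]] inside the preimage of the closed
    ray ending there, and the preimage of the open ray inside [[0, alpha[]; without atoms both rays
    have the same mass. *)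
Lemma atomless_quantile (R : realType) (P : probability (measurableTypeR R) R)
    (M alpha : R) : P `[- M, M]%classic = 1%E -> (forall r, P [set r] = 0%E) ->
  0 <= alpha <= 1 -> exists r, P `]-oo, r]%classic = alpha%:E.
Proof.
move=> PM P0 /andP[a0 a1]; have [q [qnd qM qP]] := quantile_transform PM.
have leb (b : bool) :
    lebesgue_measure [set` Interval (BLeft 0) (BSide b alpha)] = alpha%:E.
  rewrite lebesgue_measure_itv/= lte_fin; case: ltP => [_|aN].
    by rewrite sube0.
  by congr EFin; apply/eqP; rewrite eq_le a0 aN.
have mq : measurable_fun [set: measurableTypeR R]
    (q : measurableTypeR R -> measurableTypeR R).
  exact: nondecreasing_measurable.
have mpre (A : set (measurableTypeR R)) : measurable A ->
    measurable (`[0, 1]%classic `&` q @^-1` A : set (measurableTypeR R)).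
  move=> mA; apply: measurableI; first exact: measurable_itv.
  by have := mq measurableT _ mA; rewrite setTI.
exists (q alpha); apply/eqP; rewrite eq_le; apply/andP; split.
  rewrite -(leb true) -(@setUitv1 _ _ -oo%O (q alpha) true)//.
  rewrite measureU0; [|exact: measurable_itv|exact: measurable_set1|exact: P0].
  rewrite -[leLHS]/(P `]-oo, q alpha[%classic) -qP; last exact: measurable_itv.
  apply: le_measure; rewrite ?inE.
  - by apply: mpre; exact: measurable_itv.
  - exact: measurable_itv.
  - move=> u [/=]; rewrite !in_itv/= => /andP[-> _]; apply: contraTT.
    by rewrite -!leNgt; exact: qnd.
rewrite -(leb false) -qP; last exact: measurable_itv.
apply: le_measure; rewrite ?inE.
- exact: measurable_itv.
- by apply: mpre; exact: measurable_itv.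
- move=> u /=; rewrite !in_itv/= => /andP[-> ua]; rewrite (le_trans ua a1).
  by split => //; exact: qnd.
Qed.

(** The law of [|x|^2] under the uniform measure has no atoms because spheres are null, so its
    distribution function takes the value [alpha] at some [r]; then [s] is the square root of
    [r]. *)
Lemma truncation_quantile (R : realType) n (K : set 'rV[R]_n.+1) (alpha : R) :
    convex_body K -> 0 < alpha < 1 ->
  exists2 s : R, 0 < s &
    lebesgue_rV n.+1 (truncation K s) = (alpha * Vol K)%:E.
Proof.
move=> cK /andP[a0 a1]; have mK := convex_body_measurable cK.
have K0oo := lebesgue_rV_convex_body cK.
have [bK _ _ _] := cK.
have mN : measurable_fun [set: 'rV[R]_n.+1]
    (fun x => inner x x : measurableTypeR R) by exact: measurable_inner.
pose X : {RV (uniform_measure K) >-> measurableTypeR R} := HB.pack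
  (fun x : 'rV[R]_n.+1 => inner x x : measurableTypeR R)
  (isMeasurableFun.Build _ _ _ _ _ mN).
pose P : probability (measurableTypeR R) R :=
  distribution (uniform_measure K) X.
have PE A : P A =
    (lebesgue_rV n.+1 ([set x | A (inner x x)] `&` K) * (Vol K)^-1%:E)%E.
  by rewrite -uniform_measureE.
have [K0 Koo] := andP K0oo.
have V0 : 0 < Vol K by apply: fine_gt0; rewrite K0.
have KE : lebesgue_rV n.+1 K = (Vol K)%:E by rewrite fineK// ge0_fin_numE.
have [M QM] := quadratic_bounded 1 bK.
have PM : P `[- (M + 1), M + 1]%classic = 1%E.
  rewrite PE setIidr; first by rewrite KE -EFinM divff// gt_eqF.
  move=> x /QM; rewrite mul1r ler_norml /= in_itv/= => /andP[_].
  have := inner_ge0 x; lra.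
have mNK (A : set (measurableTypeR R)) : measurable A ->
    measurable ([set x : 'rV[R]_n.+1 | A (inner x x)] `&` K).
  move=> mA; apply: measurableI => //.
  by have := mN measurableT _ mA; rewrite setTI.
have sph r : lebesgue_rV n.+1 ([set x | inner x x = r] `&` K) = 0%E.
  apply/eqP; rewrite eq_le measure_ge0 andbT -[leRHS](lebesgue_rV_sphere n r).
  have mS : measurable [set x : 'rV[R]_n.+1 | inner x x = r].
    by have := mN measurableT _ (measurable_set1 r); rewrite setTI.
  apply: le_measure; rewrite ?inE; [|exact: mS|exact: subIsetl].
  exact: measurableI.
have P0 r : P [set r] = 0%E by rewrite PE sph mul0e.
have [|r Pr] := atomless_quantile PM P0 (alpha := alpha); first by rewrite !ltW.
(* A ray ending at [r <= 0] has no more mass than the atom at 0, that is none, whereas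
   [alpha > 0]. *)
have r0 : 0 < r.
  rewrite ltNge; apply/negP => r0.
  have : P `]-oo, r]%classic = 0%E.
    apply/eqP; rewrite eq_le measure_ge0 andbT -(P0 0).
    rewrite !PE; apply: lee_wpmul2r; first by rewrite lee_fin invr_ge0 ltW.
    apply: le_measure; rewrite ?inE; [exact: mNK|exact: mNK|].
    move=> x [/=]; rewrite in_itv/= => xr Kx; split => //; apply/eqP.
    by rewrite eq_le (le_trans xr r0) inner_ge0.
  by rewrite Pr => /eqP; rewrite eqe gt_eqF.
exists (Num.sqrt r); first by rewrite sqrtr_gt0.
rewrite truncationE ?sqrtr_gt0//.
move: Pr; rewrite PE => Pr.
have -> : K `&` [set x | enorm x <= Num.sqrt r] =
    [set x | `]-oo, r]%classic (inner x x)] `&` K.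
  rewrite setIC; congr (_ `&` _); apply/seteqP; split => x /=;
    by rewrite in_itv/= /enorm ler_sqrt // ltW.
have := congr1 (fun z => z * (Vol K)%:E)%E Pr.
rewrite -muleA -EFinM mulVf ?gt_eqF// mule1 => ->.
by rewrite EFinM.
Qed.

(** Sum the isotropy identity over the standard basis. *)
Lemma isotropic_second_moment (R : realType) n (K : set 'rV[R]_n) :
  convex_body K -> isotropic K ->
  (\int[lebesgue_rV n]_(x in K) (inner x x)%:E = (n%:R * Vol K)%:E)%E.
Proof.
move=> cK [_ iK]; have mK := convex_body_measurable cK.
have V0 : 0 < Vol K.
  by apply: fine_gt0; have := lebesgue_rV_convex_body cK.
pose e (i : 'I_n) : 'rV[R]_n := delta_mx ord0 i.
have eE i x : inner (e i) x = x ord0 i.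
  rewrite /inner (bigD1 i)//= big1 ?addr0; first by rewrite mxE !eqxx mul1r.
  by move=> j ji; rewrite mxE (negbTE ji) andbF mul0r.
have mc i : measurable_fun K (fun x : 'rV[R]_n => (x ord0 i ^+ 2)%:E).
  apply/measurable_EFinP; apply: measurable_funTS; apply: measurable_funX.
  exact: measurable_coord.
have inti i : (\int[lebesgue_rV n]_(x in K) (x ord0 i ^+ 2)%:E = (Vol K)%:E)%E.
  have := iK (e i); rewrite enorm_sqr eE mxE !eqxx /Rintegral [RHS]/=.
  under eq_integral do rewrite eE.
  set I := (\int[_]_(x in K) _)%E => IE.
  have I0 : (0 <= I)%E by apply: integral_ge0 => x _; rewrite lee_fin sqr_ge0.
  have fI : fine I = Vol K.
    have := congr1 (fun z => Vol K * z) IE.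
    by rewrite mulrA divff ?gt_eqF// mul1r mulr1.
  (* Isotropy is stated with real integrals, where an infinite value is read as 0; [Vol K > 0]
     therefore forces [I] to be finite. *)
  move: I0 fI; case: I {IE} => [r _ /= ->//|_ /= VE|//].
  by rewrite -VE ltxx in V0.
transitivity (\sum_(i < n) \int[lebesgue_rV n]_(x in K) (x ord0 i ^+ 2)%:E)%E.
  rewrite -ge0_integral_sum//; last by move=> i x _; rewrite lee_fin sqr_ge0.
  by apply: eq_integral => x _; rewrite sumEFin.
under eq_bigr do rewrite inti.
by rewrite sumEFin sumr_const card_ord mulr_natl.
Qed.

Lemma fine_EFin_mul (R : realType) (c : R) (x : \bar R) : 0 < c ->
  fine (c%:E * x)%E = c * fine x.
Proof.
move=> c0; case: x => [r//||] /=; rewrite mulr0.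
  by rewrite gt0_muley ?lte_fin.
by rewrite gt0_muleNy ?lte_fin.
Qed.

Lemma Rintegral_uniform_measure (R : realType) n (K : set 'rV[R]_n)
    (f : 'rV[R]_n -> R) : measurable K -> (0 < lebesgue_rV n K < +oo)%E ->
    measurable_fun setT f -> (forall x, 0 <= f x) ->
  \int[uniform_measure K]_(x in K) f x =
  (Vol K)^-1 * \int[lebesgue_rV n]_(x in K) f x.
Proof.
move=> mK K0oo mf f0; rewrite /Rintegral integral_uniform_measure//.
by rewrite fine_EFin_mul// invr_gt0 fine_gt0.
Qed.

(** The lower side of the assumption, cleared of denominators: the mean of [|x|^2] over [K] is
    [n]. *)
Lemma truncation_mean_ge (R : realType) n (A s alpha : R) (K : set 'rV[R]_n) :
    convex_body K -> isotropic K -> (0 < n)%N -> 0 < s -> 0 < alpha ->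
    lebesgue_rV n (truncation K s) = (alpha * Vol K)%:E ->
    `| (\int[uniform_measure (truncation K s)]_(x in truncation K s)
            (enorm x ^+ 2))
         / (\int[uniform_measure K]_(x in K) (enorm x ^+ 2)) - 1 | <= A ->
  ((n%:R * (1 - A) * (alpha * Vol K))%:E <=
     \int[lebesgue_rV n]_(x in truncation K s) (inner x x)%:E)%E.
Proof.
move=> cK iK n0 s0 a0 Ks H; have mK := convex_body_measurable cK.
have K0oo := lebesgue_rV_convex_body cK.
have V0 : 0 < Vol K by apply: fine_gt0.
have mT := measurable_truncation s0 mK.
have aV0 : 0 < alpha * Vol K by exact: mulr_gt0.
have T0oo : (0 < lebesgue_rV n (truncation K s) < +oo)%E.
  by rewrite Ks lte_fin aV0 ltry.
have nR0 : (0 : R) < n%:R by rewrite ltr0n.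
have mN : measurable_fun [set: 'rV[R]_n] (fun x => inner x x).
  exact: measurable_inner.
have normE : (fun x : 'rV[R]_n => enorm x ^+ 2) = fun x => inner x x.
  by apply/funext => x; exact: enorm_sqr.
move: H; rewrite normE !Rintegral_uniform_measure//; try exact: inner_ge0.
have VT : Vol (truncation K s) = alpha * Vol K by rewrite {1}/Vol Ks.
have IK : \int[lebesgue_rV n]_(x in K) inner x x = n%:R * Vol K.
  by rewrite /Rintegral isotropic_second_moment.
rewrite VT IK.
rewrite [n%:R * _]mulrC mulKf ?gt_eqF// /Rintegral.
set I := (\int[_]_(x in _) _)%E => H.
have I0 : (0 <= I)%E.
  by apply: integral_ge0 => x _; rewrite lee_fin inner_ge0.
move: H I0; case: I => [r|_ _|//] /=; last by rewrite leey.
move=> /ler_normlP[+ _] _; rewrite opprB lee_fin.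
rewrite lerBlDr -lerBlDl => H.
have : (1 - A) * (n%:R * (alpha * Vol K)) <= r.
  rewrite -ler_pdivlMr ?mulr_gt0//; apply: le_trans H _.
  by rewrite le_eqVlt; apply/orP; left; apply/eqP; field; rewrite !gt_eqF.
by rewrite mulrCA mulrA.
Qed.

(** Choose radii [a] and [b] of relative volumes 1/8 and 7/8. The lower bounds on the means force
    [a^2 >= n (1 - A)] and [b^2 <= n (1 + 7 A)], so a deviation above [7 A] occurs only within
    radius [a] or beyond radius [b], on relative volume at most 1/4. *)
Lemma isotropic_central_tail (R : realType) n (A : R) (K : set 'rV[R]_n) :
    (0 < n)%N -> 0 < A -> convex_body K -> isotropic K ->
    (forall s : R, 0 < s ->
      8^-1 <= Vol (truncation K s) / Vol K <= 7 / 8 ->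
      `| (\int[uniform_measure (truncation K s)]_(x in truncation K s)
            (enorm x ^+ 2))
         / (\int[uniform_measure K]_(x in K) (enorm x ^+ 2)) - 1 | <= A) ->
  (4%:E * lebesgue_rV n
     (K `&` [set x | 7 * A < `|n%:R^-1 * inner x x - 1|]%R) <=
   lebesgue_rV n K)%E.
Proof.
move=> n0 A0 cK iK HA; have mK := convex_body_measurable cK.
have K0oo := lebesgue_rV_convex_body cK.
have V0 : 0 < Vol K by apply: fine_gt0.
have KE : lebesgue_rV n K = (Vol K)%:E.
  by rewrite fineK// ge0_fin_numE//; case/andP: K0oo.
have nR0 : (0 : R) < n%:R by rewrite ltr0n.
have quant (alpha : R) : 0 < alpha < 1 -> exists2 s : R, 0 < s &
    lebesgue_rV n (truncation K s) = (alpha * Vol K)%:E.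
  case: n n0 K {HA mK K0oo V0 KE nR0} cK iK => // n _ K cK _.
  exact: truncation_quantile.
have [|a a0 Ka] := quant 8^-1; first by lra.
have [|b b0 Kb] := quant (7 / 8); first by lra.
have ratio (s alpha : R) :
    lebesgue_rV n (truncation K s) = (alpha * Vol K)%:E ->
    Vol (truncation K s) / Vol K = alpha.
  by move=> Ks; rewrite {1}/Vol Ks /= mulfK// gt_eqF.
have Ia : ((n%:R * (1 - A) * (8^-1 * Vol K))%:E <=
     \int[lebesgue_rV n]_(x in truncation K a) (inner x x)%:E)%E.
  apply: truncation_mean_ge => //; apply: HA => //.
  by rewrite (ratio _ _ Ka); lra.
have Ib : ((n%:R * (1 - A) * (7 / 8 * Vol K))%:E <=
     \int[lebesgue_rV n]_(x in truncation K b) (inner x x)%:E)%E.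
  apply: truncation_mean_ge => //; apply: HA => //.
  by rewrite (ratio _ _ Kb); lra.
have mTa := measurable_truncation a0 mK.
have mTb := measurable_truncation b0 mK.
have KbD : lebesgue_rV n (K `\` truncation K b) = (8^-1 * Vol K)%:E.
  rewrite measureD//; last by case/andP: K0oo.
  rewrite setIidr; last exact: subIsetl.
  transitivity ((Vol K)%:E - (7 / 8 * Vol K)%:E)%E.
    by congr (_ - _)%E; [exact: KE|exact: Kb].
  by rewrite -EFinB; congr EFin; field.
have mN (D : set 'rV[R]_n) : measurable_fun D (fun x => (inner x x)%:E).
  apply: measurable_funTS; apply/measurable_EFinP; exact: measurable_inner.
have N0 x : (0 <= (@inner R n x x)%:E)%E by rewrite lee_fin inner_ge0.
have enorm_le s (x : 'rV[R]_n) : 0 < s ->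
    (enorm x <= s) = (inner x x <= s ^+ 2).
  by move=> s0; rewrite -enorm_sqr ler_sqr// nnegrE ?sqrtr_ge0// ltW.
have na : n%:R * (1 - A) <= a ^+ 2.
  have : (\int[lebesgue_rV n]_(x in truncation K a) (inner x x)%:E <=
      (a ^+ 2)%:E * lebesgue_rV n (truncation K a))%E.
    rewrite -integral_cst//; apply: ge0_le_integral => //.
    by move=> x; rewrite truncationE// => -[_ /=]; rewrite enorm_le// lee_fin.
  move=> /(le_trans Ia); rewrite Ka -EFinM lee_fin ler_pM2r//.
  by rewrite mulr_gt0.
(* Beyond [b] the integral of [|x|^2] is at least [b^2 / 8] and at most
   [n - 7/8 n (1 - A) = n (1 + 7 A) / 8], in units of [Vol K]. The factor 7 is the ratio of the two
   volumes. *)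
have nb : b ^+ 2 <= n%:R * (1 + 7 * A).
  have : ((b ^+ 2)%:E * lebesgue_rV n (K `\` truncation K b) <=
      \int[lebesgue_rV n]_(x in K `\` truncation K b) (inner x x)%:E)%E.
    rewrite -integral_cst//; last exact: measurableD.
    apply: ge0_le_integral => //; first exact: measurableD.
    - by move=> x _; rewrite lee_fin sqr_ge0.
    - move=> x; rewrite truncationE// => -[Kx /= nT]; rewrite lee_fin.
      rewrite leNgt; apply/negP => xb; apply: nT; split => //.
      by rewrite enorm_le// ltW.
  move=> /(leeD Ib); rewrite -ge0_integral_setU//; first last.
    by apply/disj_setPS => x [Tx [_ nTx]].
    exact: measurableD.
  rewrite setDUK; last by exact: subIsetl.
  rewrite isotropic_second_moment// KbD -EFinM -EFinD lee_fin => H.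
  rewrite -(@ler_pM2r _ (8^-1 * Vol K)); last by rewrite mulr_gt0.
  apply: le_trans (_ : _ <= n%:R * Vol K - n%:R * (1 - A) * (7 / 8 * Vol K)) _.
    lra.
  by rewrite le_eqVlt; apply/orP; left; apply/eqP; field.
set F := _ `&` _.
have mF : measurable F.
  by apply: measurableI => //; exact: measurable_quadratic_gt.
have FU : F `<=` truncation K a `|` (K `\` truncation K b).
  move=> x [Kx /=]; rewrite !truncationE//.
  have [Q0|Q0] := leP 0 (n%:R^-1 * inner x x - 1).
    rewrite ger0_norm// => Qx; right; split => // -[_ /=].
    rewrite enorm_le// leNgt => /negP; apply.
    apply: le_lt_trans nb _; rewrite mulrC -ltr_pdivlMr// mulrC; lra.
  rewrite ltr0_norm// => Qx; left; split => //=.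
  rewrite enorm_le//; apply: le_trans na.
  rewrite mulrC -ler_pdivrMr// mulrC; lra.
have : (lebesgue_rV n F <=
    lebesgue_rV n (truncation K a) + lebesgue_rV n (K `\` truncation K b))%E.
  apply: le_trans (measureU2 _ mTa (measurableD mK mTb)).
  apply: le_measure; rewrite ?inE//.
  by apply: measurableU => //; exact: measurableD.
rewrite Ka KbD -EFinD KE.
move=> /(lee_wpmul2l (_ : 0 <= 4%:E)%E)/le_trans; apply.
  by rewrite lee_fin.
by rewrite -EFinM lee_fin; lra.
Qed.

Theorem proposition6p4 (R : realType) :
  exists C : R, 0 < C /\
  forall (n : nat) (A : R) (K : set 'rV[R]_n),
    (0 < n)%N -> 0 < A -> convex_body K -> isotropic K ->
    (forall s : R, 0 < s ->
      8^-1 <= Vol (truncation K s) / Vol K <= 7 / 8 ->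
      `| (\int[uniform_measure (truncation K s)]_(x in truncation K s)
            (enorm x ^+ 2))
         / (\int[uniform_measure K]_(x in K) (enorm x ^+ 2)) - 1 | <= A) ->
    \int[uniform_measure K]_(x in K) ((enorm x ^+ 2 / n%:R - 1) ^+ 2)
      <= C * A ^+ 2.
Proof.
(* The second moment bound [64 delta^2 * 200 * 14^4] at [delta = 7 A]. *)
exists (64 * 7 ^+ 2 * (200 * 14 ^+ 4)); split.
  by rewrite !mulr_gt0// exprn_gt0.
move=> n A K n0 A0 cK iK HA; have mK := convex_body_measurable cK.
have K0oo := lebesgue_rV_convex_body cK.
have V0 : 0 < Vol K by apply: fine_gt0.
have QE : (fun x : 'rV[R]_n => (enorm x ^+ 2 / n%:R - 1) ^+ 2) =
    fun x => (n%:R^-1 * inner x x - 1) ^+ 2.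
  by apply/funext => x; rewrite enorm_sqr [_ / _]mulrC.
rewrite QE Rintegral_uniform_measure//; last first.
  by move=> x; exact: sqr_ge0.
  by apply: measurable_funX; exact: measurable_quadratic.
have A7 : 0 < 7 * A by rewrite mulr_gt0.
have := quadratic_second_moment cK A7 (isotropic_central_tail n0 A0 cK iK HA).
have -> : lebesgue_rV n K = (Vol K)%:E.
  by rewrite fineK// ge0_fin_numE//; case/andP: K0oo.
rewrite /Rintegral; set I := (\int[_]_(x in _) _)%E => H.
rewrite [leLHS]mulrC ler_pdivrMr//.
have I0 : (0 <= I)%E by apply: integral_ge0 => x _; rewrite lee_fin sqr_ge0.
rewrite -lee_fin fineK; last first.
  by rewrite ge0_fin_numE// (le_lt_trans H)// ltry.
apply: le_trans H _; rewrite -EFinM lee_fin exprMn.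
rewrite le_eqVlt; apply/orP; left; apply/eqP.
by move: (200 * 14 ^+ 4) (7 ^+ 2) => S a; ring.
Qed.
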